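(* The intersection $\overline{\mathrm{o\Delta}}\cap\mathrm{oD}$ is described by the equation $$\bar K(m_1)E(m_2)+\bar E(m_1)K(m_2)=\bar K(m_1)K(m_2),$$ that is, for $1<a<t$ the point $(a,a,t)\in\mathrm{oD}$ lies in the closure of $\mathrm{o\Delta}$ if and only if this equation holds, where $$m_1=\frac{a^2-1}{t^2-1},\qquad m_2=\frac{t^2}{a^2}\,\frac{a^2-1}{t^2-1},$$ $K(m)=\int_0^{\pi/2}\frac{d\theta}{\sqrt{1-m\sin^2\theta}}$ and $E(m)=\int_0^{\pi/2}\sqrt{1-m\sin^2\theta}\,d\theta$ are the complete elliptic integrals of the first and second kind, and $\bar K(m)=K(1-m)$, $\bar E(m)=E(1-m)$ are the associated elliptic integrals.
   Context: For real numbers with $-t<-a<-1<1<b<t$ put $(v_1,v_2,v_3,v_4,v_5,v_6)=(-t,-a,-1,1,b,t)$ and, for $1\le k\le5$, $$I_k=\int_{v_k}^{v_{k+1}}\sqrt{\frac{|z-b|}{|z+a|\,|z^2-1|\,|z^2-t^2|}}\,dz,\qquad J_k=\int_{v_k}^{v_{k+1}}\sqrt{\frac{|z+a|}{|z-b|\,|z^2-1|\,|z^2-t^2|}}\,dz,$$ $$Q(a,b;t)=\frac{I_1+I_5}{I_2+I_4}-\frac{J_1+J_5}{J_2+J_4}.$$ Define the subsets of $\mathbb R^3$ $$\mathrm{oD}=\{(a,b,t): Q(a,b;t)=0,\ a=b,\ -t<-a<-1<1<b<t\},$$ $$\mathrm{o\Delta}=\{(a,b,t): Q(a,b;t)=0,\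 a\neq b,\ -t<-a<-1<1<b<t\}.$$ (These parametrize two families of triply periodic minimal surfaces.) The closure $\overline{\mathrm{o\Delta}}$ is taken in the parameter space. *)

(* Defs.v *)
From Stdlib Require Import Reals.
From Coquelicot Require Import Coquelicot.
Open Scope R_scope.

(* Junk value t for k outside 1..6. *)
Definition vertex (a b t : R) (k : nat) : R :=
  match k with
  | 1%nat => - t
  | 2%nat => - a
  | 3%nat => - 1
  | 4%nat => 1
  | 5%nat => b
  | _ => t
  end.

(* Improper Riemann integral over the open interval ]x, y[ : the integrands
   below blow up at some of the endpoints. *)
Definition improper_RInt (f : R -> R) (x y : R) : R :=
  RInt_gen f (at_right x) (at_left y).

Definition period_I (a b t : R) (k : nat) : R :=
  improper_RInt
    (fun z => sqrt (Rabs (z - b) /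
                    (Rabs (z + a) * Rabs (z ^ 2 - 1) * Rabs (z ^ 2 - t ^ 2))))
    (vertex a b t k) (vertex a b t (S k)).

Definition period_J (a b t : R) (k : nat) : R :=
  improper_RInt
    (fun z => sqrt (Rabs (z + a) /
                    (Rabs (z - b) * Rabs (z ^ 2 - 1) * Rabs (z ^ 2 - t ^ 2))))
    (vertex a b t k) (vertex a b t (S k)).

Definition Q (a b t : R) : R :=
  (period_I a b t 1 + period_I a b t 5) / (period_I a b t 2 + period_I a b t 4)
  - (period_J a b t 1 + period_J a b t 5) / (period_J a b t 2 + period_J a b t 4).

Definition admissible (a b t : R) : Prop :=
  - t < - a /\ - a < - 1 /\ - 1 < 1 /\ 1 < b /\ b < t.

Definition oD (p : R * R * R) : Prop :=
  let '(a, b, t) := p in Q a b t = 0 /\ a = b /\ admissible a b t.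

Definition oDelta (p : R * R * R) : Prop :=
  let '(a, b, t) := p in Q a b t = 0 /\ a <> b /\ admissible a b t.

Definition closure {T : UniformSpace} (D : T -> Prop) (x : T) : Prop :=
  forall P : T -> Prop, locally x P -> exists y : T, P y /\ D y.

(* The argument of the elliptic integrals is the parameter m, not the
   modulus k (m = k^2). *)
Definition ellK (m : R) : R :=
  RInt (fun theta => 1 / sqrt (1 - m * sin theta ^ 2)) 0 (PI / 2).

Definition ellE (m : R) : R :=
  RInt (fun theta => sqrt (1 - m * sin theta ^ 2)) 0 (PI / 2).

Definition ellK_bar (m : R) : R := ellK (1 - m).

Definition ellE_bar (m : R) : R := ellE (1 - m).

Definition m1 (a t : R) : R := (a ^ 2 - 1) / (t ^ 2 - 1).

Definition m2 (a t : R) : R := t ^ 2 / a ^ 2 * ((a ^ 2 - 1) / (t ^ 2 - 1)).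

(* Main.v *)
(* Put c = (a + b) / 2 and s = (b - a) / 2.  A change of variables turns the
   periods into integrals over [0, PI/2] of integrands that are smooth in (s, c, t)
   up to s = 0.  Swapping a and b exchanges I_k with J_(6-k), so Q is odd in s and
   Q = s * (positive factor) * gap with gap continuous; off the diagonal, Q = 0 means
   gap = 0.  At s = 0 the curve w^2 = (z-b)(z+a)(z^2-1)(z^2-t^2) covers two elliptic
   curves, of parameters m_1 and m_2, and gap becomes a positive multiple of
   H = Kbar(m_1)E(m_2) + Ebar(m_1)K(m_2) - Kbar(m_1)K(m_2).  So H = 0 at every
   diagonal point in the closure.  Conversely, for fixed m_1, H is strictly decreasing
   in m_2, hence gap changes sign along the curve m_1 = const through a zero of H;
   this persists for small s <> 0 and the intermediate value theorem yields
   off-diagonal zeros of Q nearby. *)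
Require Import Defs.
From Stdlib Require Import Reals Lra Psatz ClassicalEpsilon Ranalysis5.
From Coquelicot Require Import Coquelicot.
Open Scope R_scope.

(** * Continuity and integration *)

(** The obstacle is that the endpoint [b] moves with [s] while the integrands are singular there, so
    the periods cannot be differentiated in [s] as they stand. The substitutions are chosen so that
    the endpoint zeros of [w] become exact factors [sin th] and [cos th], which the derivative of
    [z] cancels. Since [z - b = (z - s) - c] and [z + a = (z - s) + c], every period combines the
    integrals of [dz / |w|] (integrands [h]) and of [(z - s) dz / |w|] (integrands [y]). The
    reflection [z -> - z] expresses the periods on the negative side by these integrals at [- s].
    After cross-multiplication the numerator of [Q] contains only sums over [s] and [- s] of [y_out]
    and [h_in], and differences of [h_out] and [y_in]. The differences vanish at [s = 0], so only
    [h_out] and [y_in] need slopes in [s]. These slopes are exact difference quotients, not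
    derivatives: algebra replaces a Taylor estimate, and what remains is the continuity in the
    parameters of integrals over a fixed compact interval. *)

Section Continuity.

Context {U : UniformSpace}.
Implicit Types (f g : U -> R) (u : U).

Lemma cont_add f g u :
  continuous f u -> continuous g u -> continuous (fun v => f v + g v) u.
Proof. exact (continuous_plus (V := R_NormedModule) f g u). Qed.

Lemma cont_opp f u : continuous f u -> continuous (fun v => - f v) u.
Proof. exact (continuous_opp (V := R_NormedModule) f u). Qed.

Lemma cont_sub f g u :
  continuous f u -> continuous g u -> continuous (fun v => f v - g v) u.
Proof. exact (continuous_minus (V := R_NormedModule) f g u). Qed.

Lemma cont_mul f g u :
  continuous f u -> continuous g u -> continuous (fun v => f v * g v) u.
Proof. exact (continuous_mult (K := R_AbsRing) f g u). Qed.

Lemma cont_pow f n u : continuous f u -> continuous (fun v => f v ^ n) u.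
Proof.
  intros Hf; induction n as [|n IH]; simpl.
  - apply continuous_const.
  - now apply cont_mul.
Qed.

Lemma cont_div f g u :
  continuous f u -> continuous g u -> g u <> 0 ->
  continuous (fun v => f v / g v) u.
Proof.
  intros Hf Hg Hn; apply cont_mul; [exact Hf|].
  apply (continuous_comp g Rinv); [exact Hg|].
  now apply continuous_Rinv.
Qed.

Lemma cont_sqrt f u : continuous f u -> continuous (fun v => sqrt (f v)) u.
Proof. intros Hf; apply (continuous_comp f sqrt); [exact Hf|apply continuous_sqrt]. Qed.

Lemma cont_abs f u : continuous f u -> continuous (fun v => Rabs (f v)) u.
Proof. intros Hf; apply (continuous_comp f Rabs); [exact Hf|apply continuous_Rabs]. Qed.

Lemma cont_sin f u : continuous f u -> continuous (fun v => sin (f v)) u.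
Proof. intros Hf; apply (continuous_comp f sin); [exact Hf|apply continuous_sin]. Qed.

Lemma cont_cos f u : continuous f u -> continuous (fun v => cos (f v)) u.
Proof. intros Hf; apply (continuous_comp f cos); [exact Hf|apply continuous_cos]. Qed.

End Continuity.

(** Hypotheses come before the structural rules, so a function whose continuity is in the context is
    treated as an atom. A nonvanishing condition for a denominator is left as a goal unless it is an
    assumption. *)
Ltac cont :=
  repeat first
    [ match goal with
      | H : continuous _ _ |- continuous _ _ => exact H
      | |- continuous (fun _ => ?k) _ => apply continuous_const
      | |- continuous (fun v => v) _ => apply continuous_id
      | |- continuous (fun v => @?f v + @?g v) _ => apply (cont_add f g)
      | |- continuous (fun v => @?f v - @?g v) _ => apply (cont_sub f g)
      | |- continuous (fun v => @?f v * @?g v) _ => apply (cont_mul f g)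
      | |- continuous (fun v => @?f v / @?g v) _ => apply (cont_div f g)
      | |- continuous (fun v => - @?f v) _ => apply (cont_opp f)
      | |- continuous (fun v => @?f v ^ ?n) _ => apply (cont_pow f n)
      | |- continuous (fun v => sqrt (@?f v)) _ => apply (cont_sqrt f)
      | |- continuous (fun v => Rabs (@?f v)) _ => apply (cont_abs f)
      | |- continuous (fun v => sin (@?f v)) _ => apply (cont_sin f)
      | |- continuous (fun v => cos (@?f v)) _ => apply (cont_cos f)
      end
    | lazymatch goal with |- continuous _ _ => fail | |- _ => assumption end ].

Lemma continuous_continuity (f : R -> R) x : continuous f x -> continuity_pt f x.
Proof. intros H; apply continuity_pt_filterlim; exact H. Qed.

Lemma ex_RInt_cont (f : R -> R) a b : (forall x, continuous f x) -> ex_RInt f a b.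
Proof. intros H; apply (ex_RInt_continuous (V := R_CompleteNormedModule)); auto. Qed.

(* [RInt] returns in the carrier of a module; [ring] and [field] want [R]. *)
Ltac eq_R := match goal with |- @eq _ ?x ?y => change (@eq R x y) end.

Lemma RInt_eq (f g : R -> R) a b : (forall x, f x = g x) -> RInt f a b = RInt g a b.
Proof. intros H; apply RInt_ext; intros x _; apply H. Qed.

Lemma RInt_add (f g : R -> R) a b :
  (forall x, continuous f x) -> (forall x, continuous g x) ->
  RInt (fun x => f x + g x) a b = RInt f a b + RInt g a b.
Proof.
  intros Hf Hg; apply (RInt_plus (V := R_CompleteNormedModule)); now apply ex_RInt_cont.
Qed.

Lemma RInt_sub (f g : R -> R) a b :
  (forall x, continuous f x) -> (forall x, continuous g x) ->
  RInt (fun x => f x - g x) a b = RInt f a b - RInt g a b.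
Proof.
  intros Hf Hg; apply (RInt_minus (V := R_CompleteNormedModule)); now apply ex_RInt_cont.
Qed.

Lemma RInt_mulc (f : R -> R) k a b :
  (forall x, continuous f x) -> RInt (fun x => k * f x) a b = k * RInt f a b.
Proof.
  intros Hf; apply (RInt_scal (V := R_CompleteNormedModule)); now apply ex_RInt_cont.
Qed.

Lemma RInt_reflect (f : R -> R) b :
  (forall x, continuous f x) -> RInt (fun x => f (b - x)) 0 b = RInt f 0 b.
Proof.
  intros Hf.
  assert (H := is_RInt_comp_lin f (-1) b 0 b (RInt f (-1 * 0 + b) (-1 * b + b))
     (RInt_correct f _ _ (ex_RInt_cont f _ _ Hf))).
  replace (-1 * 0 + b) with b in H by ring; replace (-1 * b + b) with 0 in H by ring.
  apply is_RInt_opp in H.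
  apply is_RInt_unique.
  replace (RInt f 0 b) with (opp (RInt f b 0)).
  - eapply is_RInt_ext; [|exact H].
    intros x _; unfold opp, scal; simpl; unfold mult; simpl.
    replace (-1 * x + b) with (b - x) by ring; ring.
  - unfold opp; simpl; rewrite <- (opp_RInt_swap (V := R_CompleteNormedModule) f).
    + unfold opp; simpl; lra.
    + now apply ex_RInt_cont.
Qed.

(** Joint continuity at the points [(x, p0)] gives a radius for each [x]; compactness of [[a, b]]
    makes the radius uniform, and the difference of the integrals is then at most [(b - a) * e]. *)
Lemma continuous_RInt_param {U : UniformSpace} (q : R -> U -> R) (a b : R) (p0 : U) :
  a <= b ->
  locally p0 (fun p => forall x, continuous (fun y => q y p) x) ->
  (forall x, a <= x <= b ->
     continuous (fun v : R * U => q (fst v) (snd v)) (x, p0)) ->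
  continuous (fun p => RInt (fun x => q x p) a b) p0.
Proof.
  intros Hab Hloc Hq.
  apply (proj2 (filterlim_locally _ _)); intros eps.
  (* The summand 1 covers the case [a = b]; the factor 2 makes the final bound [eps / 2], hence
     strict. *)
  pose (e := eps / (2 * (b - a + 1))).
  assert (He : 0 < e).
  { apply Rdiv_lt_0_compat; [apply eps|lra]. }
  assert (Hd : forall x, exists d : posreal, a <= x <= b ->
     forall y p, Rabs (y - x) < d -> ball p0 d p -> Rabs (q y p - q x p0) < e / 2).
  { intros x.
    destruct (Rle_dec a x) as [Hax|]; [|exists (mkposreal 1 Rlt_0_1); lra].
    destruct (Rle_dec x b) as [Hxb|]; [|exists (mkposreal 1 Rlt_0_1); lra].
    assert (He2 : 0 < e / 2) by lra.
    destruct (proj1 (filterlim_locally _ _) (Hq x (conj Hax Hxb)) (mkposreal _ He2)) as [d Hd].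
    exists d; intros _ y p Hy Hp.
    exact (Hd (y, p) (conj Hy Hp)). }
  pose (delta := fun x => proj1_sig (constructive_indefinite_description _ (Hd x))).
  assert (Hdelta : forall x, a <= x <= b -> forall y p, Rabs (y - x) < delta x ->
     ball p0 (delta x) p -> Rabs (q y p - q x p0) < e / 2).
  { intros x; exact (proj2_sig (constructive_indefinite_description _ (Hd x))). }
  destruct (compactness_value_1d a b delta) as [d Hcomp].
  destruct Hloc as [d1 Hloc].
  assert (H0 : forall x, continuous (fun y => q y p0) x) by (apply Hloc, ball_center).
  assert (Hm : 0 < Rmin d d1) by (apply Rmin_pos; [apply d|apply d1]).
  exists (mkposreal _ Hm); simpl; intros p Hp.
  assert (H1 : forall x, continuous (fun y => q y p) x).
  { apply Hloc; eapply ball_le; [|exact Hp]; apply Rmin_r. }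
  change (Rabs (RInt (fun x => q x p) a b - RInt (fun x => q x p0) a b) < eps).
  rewrite <- RInt_sub by assumption.
  apply Rle_lt_trans with ((b - a) * e).
  - apply abs_RInt_le_const; [exact Hab| |].
    + apply ex_RInt_cont; intros x; now apply cont_sub.
    (* Compactness yields the nearby centre [z] only under a double negation, so the pointwise bound
       is proved by contradiction. Both [q x p] and [q x p0] lie within [e / 2] of [q z p0]. *)
    + intros x Hx; apply Rnot_lt_le; intros Hlt.
      apply (Hcomp x Hx); intros [z [Hz [Hxz Hdz]]].
      assert (A1 := Hdelta z Hz x p Hxz).
      assert (A2 := Hdelta z Hz x p0 Hxz (ball_center _ _)).
      assert (A3 : ball p0 (delta z) p).
      { eapply ball_le; [|exact Hp]; eapply Rle_trans; [apply Rmin_l|exact Hdz]. }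
      specialize (A1 A3).
      apply Rabs_def2 in A1; apply Rabs_def2 in A2.
      apply (Rlt_irrefl e); eapply Rlt_trans; [exact Hlt|].
      apply Rabs_def1; lra.
  - apply Rle_lt_trans with ((b - a + 1) * e); [apply Rmult_le_compat_r; lra|].
    replace ((b - a + 1) * e) with (eps / 2) by (unfold e; field; lra).
    destruct eps; simpl; lra.
Qed.

(** Here [f] may blow up at both ends of the interval, while its pullback [g] is continuous
    everywhere. On compact subintervals this is the ordinary change of variables; monotonicity of
    [phi] and the intermediate value theorem carry one-sided neighbourhoods of the endpoints back to
    neighbourhoods of [al] and [be], where the integral of [g] depends continuously on its
    bounds. *)
Lemma is_RInt_gen_subst (f phi dphi g : R -> R) (al be : R) :
  al < be ->
  (forall x, is_derive phi x (dphi x)) ->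
  (forall x, continuous dphi x) ->
  (forall x, al < x < be -> 0 < dphi x) ->
  (forall x, al < x < be -> continuous f (phi x)) ->
  (forall x, continuous g x) ->
  (forall x, al < x < be -> dphi x * f (phi x) = g x) ->
  is_RInt_gen f (at_right (phi al)) (at_left (phi be)) (RInt g al be).
Proof.
  intros Hab Hphi Hdphi Hpos Hf Hg Hfg P HP.
  assert (Hcphi : forall x, continuous phi x).
  { intros x; apply (ex_derive_continuous (K := R_AbsRing) (V := R_NormedModule)); eexists; apply Hphi. }
  assert (Hinc : forall x y, al <= x -> x < y -> y <= be -> phi x < phi y).
  { intros x y Hx Hxy Hy.
    destruct (MVT_cor2 phi dphi x y Hxy) as [w [Hw1 Hw2]].
      { intros w _; apply is_derive_Reals, Hphi. }
    assert (0 < dphi w) by (apply Hpos; lra). nra. }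
  assert (HC := continuous_RInt (V := R_CompleteNormedModule) g al be (fun x y => RInt g x y)).
  destruct (HC (filter_forall _ (fun z => RInt_correct _ _ _ (ex_RInt_cont g _ _ Hg))) P HP)
    as [d Hd].
  (* Half of the length keeps the two preimages in opposite halves of [[al, be]], so that
     [x < y]. *)
  pose (e := Rmin d ((be - al) / 2)).
  assert (He : 0 < e) by (apply Rmin_pos; [apply d|lra]).
  assert (He1 : e <= d) by apply Rmin_l.
  assert (He2 : e <= (be - al) / 2) by apply Rmin_r.
  apply Filter_prod with (fun u => phi al < u < phi (al + e)) (fun v => phi (be - e) < v < phi be).
  - assert (Hp : 0 < phi (al + e) - phi al) by (apply Rlt_0_minus, Hinc; lra).
    exists (mkposreal _ Hp); intros u Hu Hlt.
    apply Rabs_def2 in Hu; simpl in Hu; unfold minus, plus, opp in Hu; simpl in Hu; lra.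
  - assert (Hp : 0 < phi be - phi (be - e)) by (apply Rlt_0_minus, Hinc; lra).
    exists (mkposreal _ Hp); intros u Hu Hlt.
    apply Rabs_def2 in Hu; simpl in Hu; unfold minus, plus, opp in Hu; simpl in Hu; lra.
  - intros u v Hu Hv; simpl.
    assert (Hctn : continuity phi) by (intros x; apply continuous_continuity, Hcphi).
    destruct (IVT_gen phi al (al + e) u Hctn) as [x [Hx Hxu]].
    { rewrite Rmin_left, Rmax_right by lra; lra. }
    destruct (IVT_gen phi (be - e) be v Hctn) as [y [Hy Hyv]].
    { rewrite Rmin_left, Rmax_right by lra; lra. }
    rewrite Rmin_left, Rmax_right in Hx, Hy by lra.
    assert (al < x < al + e).
    { split; apply Rnot_le_lt; intros H.
      - assert (x = al) by lra; subst x; lra.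
      - assert (x = al + e) by lra; subst x; lra. }
    assert (be - e < y < be).
    { split; apply Rnot_le_lt; intros H'.
      - assert (y = be - e) by lra; subst y; lra.
      - assert (y = be) by lra; subst y; lra. }
    exists (RInt g x y); split.
    + rewrite <- Hxu, <- Hyv.
      assert (Hin : forall z, Rmin x y <= z <= Rmax x y -> al < z < be).
      { intros z; rewrite Rmin_left, Rmax_right by lra; lra. }
      assert (Hex : ex_RInt f (phi x) (phi y)).
      { apply (ex_RInt_continuous (V := R_CompleteNormedModule)); intros w Hw.
        assert (phi x < phi y) by (apply Hinc; lra).
        rewrite Rmin_left, Rmax_right in Hw by lra.
        destruct (IVT_gen phi x y w Hctn) as [z [Hz Hzw]].
        { rewrite Rmin_left, Rmax_right by lra; lra. }
        rewrite <- Hzw; apply Hf, Hin, Hz. }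
      assert (HR := is_RInt_comp (V := R_CompleteNormedModule) f phi dphi x y
        (fun z Hz => Hf z (Hin z Hz)) (fun z _ => conj (Hphi z) (Hdphi z))).
      apply is_RInt_ext with (g := g) in HR.
      * apply (is_RInt_unique (V := R_CompleteNormedModule)) in HR; rewrite HR; now apply (RInt_correct (V := R_CompleteNormedModule)).
      * intros z Hz; apply Hfg, Hin; lra.
    + apply (Hd (x, y)); split; apply Rabs_def1;
        unfold minus, plus, opp; simpl; lra.
Qed.

Lemma is_RInt_gen_opp_var (f : R -> R) (x y l : R) :
  is_RInt_gen (fun z => f (- z)) (at_right x) (at_left y) l ->
  is_RInt_gen f (at_right (- y)) (at_left (- x)) l.
Proof.
  intros H P HP.
  destruct (H P HP) as [P1 P2 H1 H2 H12].
  apply Filter_prod with (fun u => P2 (- u)) (fun v => P1 (- v)).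
  - assert (A := filterlim_Ropp_right (- y)); rewrite Ropp_involutive in A; exact (A _ H2).
  - assert (A := filterlim_Ropp_left (- x)); rewrite Ropp_involutive in A; exact (A _ H1).
  - intros u v Hu Hv; simpl.
    destruct (H12 _ _ Hv Hu) as [l' [Hl HPl]]; exists l'; split; [|exact HPl].
    assert (Hl' := is_RInt_opp _ _ _ _ (is_RInt_swap _ _ _ _ (is_RInt_comp_opp _ _ _ _ Hl))).
    rewrite opp_opp in Hl'.
    eapply is_RInt_ext; [|exact Hl'].
    intros z _; simpl; rewrite opp_opp, Ropp_involutive; reflexivity.
Qed.

(** * Uniformizing coordinates near the diagonal *)

(** An explicit open region, symmetric in [s], containing all diagonal points. The third condition
    forces [4 |s| t < R_in], because [R_in >= (c^2 - 1) / c^2] and [c < t]; the fourth makes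
    [t^2 - c^2] dominate the terms in [s] of the outer radicands. *)
Definition near_diagonal (s c t : R) : Prop :=
  1 < c /\ c < t /\ 4 * Rabs s * t ^ 3 < c ^ 2 - 1 /\ 4 * Rabs s * t < t ^ 2 - c ^ 2.

Lemma near_diagonal_opp s c t : near_diagonal s c t -> near_diagonal (- s) c t.
Proof. unfold near_diagonal; rewrite Rabs_Ropp; auto. Qed.

Lemma near_diagonal_0 c t : 1 < c -> c < t -> near_diagonal 0 c t.
Proof. unfold near_diagonal; rewrite Rabs_R0; intros; repeat split; nra. Qed.

Lemma near_diagonal_center s c t : near_diagonal s c t -> near_diagonal 0 c t.
Proof. intros (H1 & H2 & _); now apply near_diagonal_0. Qed.

Lemma Rabs_between x : - Rabs x <= x <= Rabs x.
Proof. split; [generalize (Rle_abs (- x)); rewrite Rabs_Ropp; lra|apply Rle_abs]. Qed.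

Lemma near_diagonal_bounds s c t : near_diagonal s c t ->
  1 < c /\ c < t /\ 1 < c - s /\ 1 < c + s /\ c - s < t /\ c + s < t /\
  Rabs s < 1 /\ Rabs s < c - 1 /\ Rabs s < t - c /\ 4 * Rabs s * c ^ 2 * t < c ^ 2 - 1.
Proof.
  intros (H1 & H2 & H3 & H4).
  assert (Hs := Rabs_pos s).
  assert (Hl := Rabs_between s).
  set (r := Rabs s) in *.
  assert (Ht : 1 < t) by lra.
  assert (Hrc : r * c ^ 2 * t <= r * t ^ 3).
  { replace (r * t ^ 3) with (r * (t ^ 2 * t)) by ring.
    rewrite Rmult_assoc; apply Rmult_le_compat_l; [lra|].
    apply Rmult_le_compat_r; nra. }
  assert (Hrt : r * t <= r * c ^ 2 * t).
  { replace (r * c ^ 2 * t) with (r * t * c ^ 2) by ring.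
    assert (0 <= r * t) by nra. assert (1 <= c ^ 2) by nra. nra. }
  assert (r * t ^ 2 <= r * t ^ 3).
  { replace (r * t ^ 3) with (r * t ^ 2 * t) by ring. assert (0 <= r * t ^ 2) by nra. nra. }
  assert (Hr1 : r < c - 1).
  { apply Rnot_le_lt; intros Hn.
    assert ((c - 1) * (c + 1) <= r * (2 * t)) by (apply Rmult_le_compat; lra). nra. }
  assert (Hr2 : r < t - c).
  { apply Rnot_le_lt; intros Hn.
    assert ((t - c) * (t + c) <= r * (2 * t)) by (apply Rmult_le_compat; lra). nra. }
  assert (r < 1).
  { apply Rnot_le_lt; intros Hn.
    assert (1 * t ^ 2 <= r * t ^ 2) by (apply Rmult_le_compat_r; nra).
    assert (c ^ 2 < t ^ 2) by nra. nra. }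
  repeat split; lra.
Qed.

(* [x_out] and [x_in] are the values at [s = 0] of the substituted variables
   [z = x_out + s cos^2] on [[b, t]] and [z = x_in + s sin^2] on [[1, b]], where
   [c = (a + b) / 2] and [s = (b - a) / 2].  The shift multiplying [s] is 1 at the
   moving end [b], 0 at the fixed end, and a polynomial in [x_out^2],
   resp. [x_in^-2]; this keeps the slopes in [s] elliptic. *)
Definition x_out (c t th : R) : R := sqrt (c ^ 2 * cos th ^ 2 + t ^ 2 * sin th ^ 2).
(** With [z = x_out + s cos^2], the derivative of [z] is [sin th * cos th * M_out / x_out]. The
    factors [A_out] and [B_out] are what is left of [sqrt ((z - b) (z + a))] and [sqrt (t^2 - z^2)]
    once [sin th] and [cos th] are taken out. *)
Definition M_out (s c t th : R) : R := t ^ 2 - c ^ 2 - 2 * s * x_out c t th.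
Definition A_out (s c t th : R) : R := sqrt (M_out s c t th + s ^ 2 * sin th ^ 2).
Definition B_out (s c t th : R) : R := sqrt (M_out s c t th - s ^ 2 * cos th ^ 2).
Definition Z_out (s c t th : R) : R := sqrt ((x_out c t th + s * cos th ^ 2) ^ 2 - 1).
(** The pullback of [dz / |w|]; [y_out] is that of [(z - s) dz / |w|], since
    [z - s = x_out - s sin^2]. *)
Definition h_out (s c t th : R) : R :=
  M_out s c t th / (x_out c t th * (A_out s c t th * B_out s c t th) * Z_out s c t th).
Definition y_out (s c t th : R) : R := (x_out c t th - s * sin th ^ 2) * h_out s c t th.

Definition Delta_in (c th : R) : R := c ^ 2 * cos th ^ 2 + sin th ^ 2.
Definition x_in (c th : R) : R := c / sqrt (Delta_in c th).
(** Satisfies [x_in^2 - 1 = R_in sin^2] and [c^2 - x_in^2 = c^2 R_in cos^2]. Thus [sin th * A_in]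
    and [cos th * B_in] are the roots of [z^2 - 1] and [(b - z) (z + a)], and
    [sin th * cos th * N_in] is the derivative of [z]. *)
Definition R_in (c th : R) : R := (c ^ 2 - 1) / Delta_in c th.
Definition N_in (s c th : R) : R := R_in c th * x_in c th + 2 * s.
Definition A_in (s c th : R) : R := sqrt (R_in c th + 2 * s * x_in c th + s ^ 2 * sin th ^ 2).
Definition B_in (s c th : R) : R :=
  sqrt (c ^ 2 * R_in c th + 2 * s * x_in c th - s ^ 2 * cos th ^ 2).
Definition W_in (s c t th : R) : R := sqrt (t ^ 2 - (x_in c th + s * sin th ^ 2) ^ 2).
Definition h_in (s c t th : R) : R :=
  N_in s c th / (A_in s c th * B_in s c th * W_in s c t th).
Definition y_in (s c t th : R) : R := (x_in c th - s * cos th ^ 2) * h_in s c t th.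

(* Difference quotients in [s] with every difference of square roots rationalized, so
   that they are manifestly continuous at [s = 0]. *)
Definition h_out_slope (s c t th : R) : R :=
  let C := cos th ^ 2 in let S := sin th ^ 2 in
  let x := x_out c t th in let M := M_out s c t th in
  let AB := A_out s c t th * B_out s c t th in
  let Z := Z_out s c t th in let Z0 := Z_out 0 c t th in
  (- (s * ((S - C) * M - s ^ 2 * (S * C))) / (AB * (M + AB)) / Z
   - (2 * x * C + s * C ^ 2) / (Z * Z0 * (Z + Z0))) / x.

Definition y_in_slope (s c t th : R) : R :=
  let C := cos th ^ 2 in let S := sin th ^ 2 in
  let x := x_in c th in let r := R_in c th in
  let N := N_in s c th in
  let AB := A_in s c th * B_in s c th in
  let W := W_in s c t th in let W0 := W_in 0 c t th in
  x ^ 2 / c * ((2 * x * S + s * S ^ 2) / (W * W0 * (W + W0)))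
  + (x * ((4 * c ^ 2 * r * x - 2 * x ^ 3 * r * (1 + c ^ 2)
           + s * (4 * c ^ 2 - x ^ 2 * (4 * x ^ 2 + c ^ 2 * r * S - r * C))
           - s ^ 2 * (2 * x ^ 3 * (S - C)) + s ^ 3 * (x ^ 2 * (S * C)))
          / (c * AB * (c * N + x * AB)))
     - C * (N / AB)) / W.

Lemma cos2_sin2 th : cos th ^ 2 = 1 - sin th ^ 2.
Proof. generalize (sin2_cos2 th); unfold Rsqr; lra. Qed.

Lemma sin2_range th : 0 <= sin th ^ 2 <= 1.
Proof. generalize (cos2_sin2 th) (pow2_ge_0 (cos th)) (pow2_ge_0 (sin th)); lra. Qed.

Lemma x_out_sqr c t th : x_out c t th ^ 2 = c ^ 2 * cos th ^ 2 + t ^ 2 * sin th ^ 2.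
Proof.
  unfold x_out; rewrite pow2_sqrt; [reflexivity|].
  generalize (pow2_ge_0 (c * cos th)) (pow2_ge_0 (t * sin th)); lra.
Qed.

Lemma x_out_bounds c t th : 1 < c -> c < t -> c <= x_out c t th <= t.
Proof.
  intros H1 H2.
  assert (H := x_out_sqr c t th); rewrite cos2_sin2 in H.
  assert (Hp : 0 <= x_out c t th) by apply sqrt_pos.
  destruct (sin2_range th); set (S := sin th ^ 2) in *.
  assert (c ^ 2 <= t ^ 2) by nra.
  assert (c ^ 2 <= x_out c t th ^ 2 <= t ^ 2) by (rewrite H; split; nra).
  split; apply Rnot_lt_le; intros Hn; nra.
Qed.

Lemma Delta_in_bounds c th : 1 < c -> 1 <= Delta_in c th <= c ^ 2.
Proof.
  intros H; unfold Delta_in; rewrite cos2_sin2.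
  destruct (sin2_range th); set (S := sin th ^ 2) in *.
  assert (1 <= c ^ 2) by nra. split; nra.
Qed.

Lemma x_in_sqr c th : 1 < c -> x_in c th ^ 2 = c ^ 2 / Delta_in c th.
Proof.
  intros H; destruct (Delta_in_bounds c th H).
  unfold x_in; rewrite <- (pow2_sqrt (Delta_in c th)) at 2 by lra.
  field; apply Rgt_not_eq, sqrt_lt_R0; lra.
Qed.

Lemma x_in_bounds c th : 1 < c -> 1 <= x_in c th <= c.
Proof.
  intros H; destruct (Delta_in_bounds c th H).
  assert (Hq := x_in_sqr c th H).
  assert (0 < x_in c th).
  { unfold x_in; apply Rdiv_lt_0_compat; [lra|apply sqrt_lt_R0; lra]. }
  assert (Hq2 : x_in c th ^ 2 * Delta_in c th = c ^ 2) by (rewrite Hq; field; lra).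
  split; apply Rnot_lt_le; intros Hn.
  - assert (x_in c th ^ 2 < 1) by nra. nra.
  - assert (c ^ 2 < x_in c th ^ 2) by nra. nra.
Qed.

Lemma R_in_lower c th : 1 < c -> (c ^ 2 - 1) / c ^ 2 <= R_in c th.
Proof.
  intros H; destruct (Delta_in_bounds c th H); unfold R_in.
  apply Rmult_le_compat_l; [nra|]; apply Rinv_le_contravar; lra.
Qed.

(** Each term carrying [s] in the four quantities built from [M_out] or [R_in] is bounded by a
    multiple of [|s| t] that the margins in [near_diagonal] absorb; the other two use [|s| < c - 1]
    and [|s| < t - c]. Positivity holds for every real angle, so the integrands are continuous on
    the whole line. *)
Lemma radicands_pos s c t th : near_diagonal s c t ->
  0 < M_out s c t th - s ^ 2 * cos th ^ 2 /\
  0 < M_out s c t th /\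
  0 < M_out s c t th + s ^ 2 * sin th ^ 2 /\
  0 < (x_out c t th + s * cos th ^ 2) ^ 2 - 1 /\
  0 < N_in s c th /\
  0 < R_in c th + 2 * s * x_in c th + s ^ 2 * sin th ^ 2 /\
  0 < c ^ 2 * R_in c th + 2 * s * x_in c th - s ^ 2 * cos th ^ 2 /\
  0 < t ^ 2 - (x_in c th + s * sin th ^ 2) ^ 2.
Proof.
  intros HG; destruct (near_diagonal_bounds _ _ _ HG) as (B1 & B2 & B3 & B4 & B5 & B6 & B7 & B8 & B9 & B10).
  destruct HG as (_ & _ & _ & HG).
  destruct (x_out_bounds c t th B1 B2) as [X1 X2].
  destruct (x_in_bounds c th B1) as [Y1 Y2].
  assert (Hr := R_in_lower c th B1).
  assert (HS := sin2_range th).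
  assert (HC : 0 <= cos th ^ 2 <= 1) by (rewrite cos2_sin2; lra).
  assert (HSC := cos2_sin2 th).
  unfold M_out, N_in.
  set (x := x_out c t th) in *; set (y := x_in c th) in *; set (r := R_in c th) in *.
  set (S := sin th ^ 2) in *; set (C := cos th ^ 2) in *.
  assert (Hl := Rabs_between s).
  assert (Hs2 : s ^ 2 = Rabs s ^ 2) by (rewrite pow2_abs; reflexivity).
  assert (Hp := Rabs_pos s).
  set (q := Rabs s) in *.
  assert (Hx : - (q * t) <= s * x <= q * t) by (split; nra).
  assert (Hy : - (q * t) <= s * y <= q * t) by (split; nra).
  assert (Hqq : s ^ 2 <= q * t) by (rewrite Hs2; nra).
  assert (Hqt : q <= q * t) by nra.
  assert (H0s : 0 <= s ^ 2) by nra.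
  assert (HsC : 0 <= s ^ 2 * C <= q * t) by (split; nra).
  assert (HsS : 0 <= s ^ 2 * S) by nra.
  assert (Hr4 : 4 * (q * t) < r).
  { apply Rlt_le_trans with (2 := Hr).
    apply (Rmult_lt_reg_r (c ^ 2)); [nra|]. field_simplify; nra. }
  assert (Hrc : r <= c ^ 2 * r) by (assert (1 <= c ^ 2) by nra; nra).
  assert (Hry : r <= r * y) by nra.
  assert (HsC1 : - q <= s * C <= q) by (split; nra).
  assert (HsS1 : - q <= s * S <= q) by (split; nra).
  assert (Hx1 : 1 < x + s * C) by lra.
  assert (Hy1 : 0 < y + s * S < t) by lra.
  split; [lra|]. split; [lra|]. split; [lra|]. split; [nra|].
  split; [lra|]. split; [lra|]. split; [lra|nra].
Qed.

Lemma factors_out_pos s c t th : near_diagonal s c t ->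
  0 < x_out c t th /\ 0 < M_out s c t th /\ 0 < A_out s c t th /\
  0 < B_out s c t th /\ 0 < Z_out s c t th.
Proof.
  intros H; destruct (radicands_pos s c t th H) as (H1 & H2 & H3 & H4 & _).
  destruct H as (Hc & Hct & _).
  destruct (x_out_bounds c t th Hc Hct).
  repeat split; try assumption; try (now apply sqrt_lt_R0); lra.
Qed.

Lemma factors_in_pos s c t th : near_diagonal s c t ->
  0 < x_in c th /\ 0 < N_in s c th /\ 0 < A_in s c th /\
  0 < B_in s c th /\ 0 < W_in s c t th.
Proof.
  intros H; destruct (radicands_pos s c t th H) as (_ & _ & _ & _ & H5 & H6 & H7 & H8).
  destruct H as (Hc & Hct & _).
  destruct (x_in_bounds c th Hc).
  repeat split; try assumption; try (now apply sqrt_lt_R0); lra.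
Qed.

(** * Continuity of the integrands in parameters and angle *)

Section IntegrandContinuity.

Context {U : UniformSpace} (s c t th : U -> R) (u : U).
Hypotheses (Hs : continuous s u) (Hc : continuous c u) (Ht : continuous t u)
  (Hth : continuous th u) (Hnear : near_diagonal (s u) (c u) (t u)).

(** Throughout the section continuity is taken along arbitrary maps [s], [c], [t], [th] on a uniform
    space. One statement then serves for the angle alone, with constant parameters, and for the
    angle and the parameters jointly. *)
Lemma cont_x_out : continuous (fun v => x_out (c v) (t v) (th v)) u.
Proof. unfold x_out; cont. Qed.

Lemma cont_M_out : continuous (fun v => M_out (s v) (c v) (t v) (th v)) u.
Proof. generalize cont_x_out; intros; unfold M_out; cont. Qed.

Lemma cont_A_out : continuous (fun v => A_out (s v) (c v) (t v) (th v)) u.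
Proof. generalize cont_M_out; intros; unfold A_out; cont. Qed.

Lemma cont_B_out : continuous (fun v => B_out (s v) (c v) (t v) (th v)) u.
Proof. generalize cont_M_out; intros; unfold B_out; cont. Qed.

Lemma cont_Z_out (s' : U -> R) : continuous s' u ->
  continuous (fun v => Z_out (s' v) (c v) (t v) (th v)) u.
Proof. generalize cont_x_out; intros; unfold Z_out; cont. Qed.

Lemma cont_h_out : continuous (fun v => h_out (s v) (c v) (t v) (th v)) u.
Proof.
  generalize cont_x_out cont_M_out cont_A_out cont_B_out (cont_Z_out s Hs); intros.
  destruct (factors_out_pos _ _ _ (th u) Hnear) as (P1 & P2 & P3 & P4 & P5).
  unfold h_out; cont.
  apply Rgt_not_eq; repeat apply Rmult_lt_0_compat; assumption.
Qed.

Lemma cont_y_out : continuous (fun v => y_out (s v) (c v) (t v) (th v)) u.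
Proof. generalize cont_x_out cont_h_out; intros; unfold y_out; cont. Qed.

Lemma cont_h_out_slope : continuous (fun v => h_out_slope (s v) (c v) (t v) (th v)) u.
Proof.
  generalize cont_x_out cont_M_out cont_A_out cont_B_out (cont_Z_out s Hs)
    (cont_Z_out (fun _ => 0) (continuous_const _ _)); intros.
  destruct (factors_out_pos _ _ _ (th u) Hnear) as (P1 & P2 & P3 & P4 & P5).
  destruct (factors_out_pos _ _ _ (th u) (near_diagonal_center _ _ _ Hnear)) as (_ & _ & _ & _ & P6).
  unfold h_out_slope; cbv zeta; cont; apply Rgt_not_eq;
    repeat first [assumption | apply Rmult_lt_0_compat | apply Rplus_lt_0_compat].
Qed.

Lemma cont_Delta_in : continuous (fun v => Delta_in (c v) (th v)) u.
Proof. unfold Delta_in; cont. Qed.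

Lemma cont_x_in : continuous (fun v => x_in (c v) (th v)) u.
Proof.
  generalize cont_Delta_in; intros; unfold x_in; cont.
  apply Rgt_not_eq, sqrt_lt_R0.
  destruct Hnear as (H1 & _); destruct (Delta_in_bounds _ (th u) H1); lra.
Qed.

Lemma cont_R_in : continuous (fun v => R_in (c v) (th v)) u.
Proof.
  generalize cont_Delta_in; intros; unfold R_in; cont.
  destruct Hnear as (H1 & _); destruct (Delta_in_bounds _ (th u) H1); lra.
Qed.

Lemma cont_N_in : continuous (fun v => N_in (s v) (c v) (th v)) u.
Proof. generalize cont_x_in cont_R_in; intros; unfold N_in; cont. Qed.

Lemma cont_A_in : continuous (fun v => A_in (s v) (c v) (th v)) u.
Proof. generalize cont_x_in cont_R_in; intros; unfold A_in; cont. Qed.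

Lemma cont_B_in : continuous (fun v => B_in (s v) (c v) (th v)) u.
Proof. generalize cont_x_in cont_R_in; intros; unfold B_in; cont. Qed.

Lemma cont_W_in (s' : U -> R) : continuous s' u ->
  continuous (fun v => W_in (s' v) (c v) (t v) (th v)) u.
Proof. generalize cont_x_in; intros; unfold W_in; cont. Qed.

Lemma cont_h_in : continuous (fun v => h_in (s v) (c v) (t v) (th v)) u.
Proof.
  generalize cont_N_in cont_A_in cont_B_in (cont_W_in s Hs); intros.
  destruct (factors_in_pos _ _ _ (th u) Hnear) as (P1 & P2 & P3 & P4 & P5).
  unfold h_in; cont.
  apply Rgt_not_eq; repeat apply Rmult_lt_0_compat; assumption.
Qed.

Lemma cont_y_in : continuous (fun v => y_in (s v) (c v) (t v) (th v)) u.
Proof. generalize cont_x_in cont_h_in; intros; unfold y_in; cont. Qed.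

Lemma cont_y_in_slope : continuous (fun v => y_in_slope (s v) (c v) (t v) (th v)) u.
Proof.
  generalize cont_x_in cont_R_in cont_N_in cont_A_in cont_B_in (cont_W_in s Hs)
    (cont_W_in (fun _ => 0) (continuous_const _ _)); intros.
  destruct (factors_in_pos _ _ _ (th u) Hnear) as (P1 & P2 & P3 & P4 & P5).
  destruct (factors_in_pos _ _ _ (th u) (near_diagonal_center _ _ _ Hnear)) as (_ & _ & _ & _ & P6).
  assert (0 < c u) by (destruct Hnear; lra).
  unfold y_in_slope; cbv zeta; cont; apply Rgt_not_eq;
    repeat first [assumption | apply Rmult_lt_0_compat | apply Rplus_lt_0_compat].
Qed.

End IntegrandContinuity.

(** An exact identity without remainder. Only [M / (A * B)], equal to 1 at [s = 0], and [/ Z] depend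
    on [s]; each change is a difference of squares divided by a positive sum of roots, and the
    difference of squares contains the factor [s]. *)
Lemma h_out_expand s c t th : near_diagonal s c t ->
  h_out s c t th = h_out 0 c t th + s * h_out_slope s c t th.
Proof.
  intros H.
  assert (H0 := near_diagonal_center _ _ _ H).
  destruct (factors_out_pos _ _ _ th H) as (P1 & P2 & P3 & P4 & P5).
  destruct (factors_out_pos _ _ _ th H0) as (_ & Q2 & Q3 & Q4 & Q5).
  destruct (radicands_pos s c t th H) as (R1 & R2 & R3 & R4 & _).
  destruct (radicands_pos 0 c t th H0) as (T1 & T2 & T3 & T4 & _).
  assert (EA : A_out s c t th ^ 2 = M_out s c t th + s ^ 2 * sin th ^ 2)
    by (apply pow2_sqrt; lra).
  assert (EB : B_out s c t th ^ 2 = M_out s c t th - s ^ 2 * cos th ^ 2)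
    by (apply pow2_sqrt; lra).
  assert (EZ : Z_out s c t th ^ 2 = (x_out c t th + s * cos th ^ 2) ^ 2 - 1)
    by (apply pow2_sqrt; lra).
  assert (EZ0 : Z_out 0 c t th ^ 2 = (x_out c t th + 0 * cos th ^ 2) ^ 2 - 1)
    by (apply pow2_sqrt; lra).
  assert (EAB0 : A_out 0 c t th * B_out 0 c t th = M_out 0 c t th).
  { unfold A_out, B_out; rewrite <- sqrt_mult by lra.
    replace ((M_out 0 c t th + 0 ^ 2 * sin th ^ 2) * (M_out 0 c t th - 0 ^ 2 * cos th ^ 2))
      with (M_out 0 c t th ^ 2) by ring.
    apply sqrt_pow2; lra. }
  unfold h_out, h_out_slope; cbv zeta; rewrite EAB0; clear EAB0.
  set (x := x_out c t th) in *; set (M := M_out s c t th) in *.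
  set (A := A_out s c t th) in *; set (B := B_out s c t th) in *.
  set (Z := Z_out s c t th) in *; set (Z0 := Z_out 0 c t th) in *.
  set (M0 := M_out 0 c t th) in *.
  set (S := sin th ^ 2) in *; set (C := cos th ^ 2) in *.
  assert (HAB : 0 < A * B) by now apply Rmult_lt_0_compat.
  assert (E1 : M / (A * B) = 1 + s * (- (s * ((S - C) * M - s ^ 2 * (S * C))) / (A * B * (M + A * B)))).
  { assert (EAB : (A * B) ^ 2 = (M + s ^ 2 * S) * (M - s ^ 2 * C)) by (rewrite <- EA, <- EB; ring).
    set (p := A * B) in *.
    apply Rminus_diag_uniq.
    replace (M / p - (1 + s * (- (s * ((S - C) * M - s ^ 2 * (S * C))) / (p * (M + p)))))
      with ((M ^ 2 - p ^ 2 + s ^ 2 * ((S - C) * M - s ^ 2 * (S * C))) / (p * (M + p)))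
      by (field; lra).
    rewrite EAB; field; lra. }
  assert (E2 : / Z = / Z0 - s * ((2 * x * C + s * C ^ 2) / (Z * Z0 * (Z + Z0)))).
  { apply Rminus_diag_uniq.
    replace (/ Z - (/ Z0 - s * ((2 * x * C + s * C ^ 2) / (Z * Z0 * (Z + Z0)))))
      with ((Z0 ^ 2 - Z ^ 2 + s * (2 * x * C + s * C ^ 2)) / (Z * Z0 * (Z + Z0)))
      by (field; lra).
    rewrite EZ, EZ0; field; lra. }
  replace (M / (x * (A * B) * Z)) with (M / (A * B) * / Z / x) by (field; lra).
  replace (M0 / (x * M0 * Z0)) with (/ Z0 / x) by (field; lra).
  rewrite E1.
  set (w := (2 * x * C + s * C ^ 2) / (Z * Z0 * (Z + Z0))) in *.
  set (e := - (s * ((S - C) * M - s ^ 2 * (S * C))) / (A * B * (M + A * B))) in *.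
  replace (/ Z0) with (/ Z + s * w) by lra.
  unfold Rdiv; ring.
Qed.

(** The same rationalization, now with [N / (A * B)], whose value at [s = 0] is [x / c], and
    [/ W]. *)
Lemma y_in_expand s c t th : near_diagonal s c t ->
  y_in s c t th = y_in 0 c t th + s * y_in_slope s c t th.
Proof.
  intros H.
  assert (H0 := near_diagonal_center _ _ _ H).
  assert (Hc : 1 < c) by apply H.
  destruct (factors_in_pos _ _ _ th H) as (P1 & P2 & P3 & P4 & P5).
  destruct (factors_in_pos _ _ _ th H0) as (_ & Q2 & Q3 & Q4 & Q5).
  destruct (radicands_pos s c t th H) as (_ & _ & _ & _ & R5 & R6 & R7 & R8).
  destruct (radicands_pos 0 c t th H0) as (_ & _ & _ & _ & T5 & T6 & T7 & T8).
  assert (EA : A_in s c th ^ 2 = R_in c th + 2 * s * x_in c th + s ^ 2 * sin th ^ 2)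
    by (apply pow2_sqrt; lra).
  assert (EB : B_in s c th ^ 2 = c ^ 2 * R_in c th + 2 * s * x_in c th - s ^ 2 * cos th ^ 2)
    by (apply pow2_sqrt; lra).
  assert (EW : W_in s c t th ^ 2 = t ^ 2 - (x_in c th + s * sin th ^ 2) ^ 2)
    by (apply pow2_sqrt; lra).
  assert (EW0 : W_in 0 c t th ^ 2 = t ^ 2 - (x_in c th + 0 * sin th ^ 2) ^ 2)
    by (apply pow2_sqrt; lra).
  assert (Hr : 0 < R_in c th).
  { apply Rlt_le_trans with (2 := R_in_lower c th Hc), Rdiv_lt_0_compat; nra. }
  assert (EAB0 : A_in 0 c th * B_in 0 c th = c * R_in c th).
  { unfold A_in, B_in; rewrite <- sqrt_mult by lra.
    replace ((R_in c th + 2 * 0 * x_in c th + 0 ^ 2 * sin th ^ 2) *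
       (c ^ 2 * R_in c th + 2 * 0 * x_in c th - 0 ^ 2 * cos th ^ 2))
      with ((c * R_in c th) ^ 2) by ring.
    apply sqrt_pow2; nra. }
  unfold y_in, h_in, y_in_slope; cbv zeta; rewrite EAB0; clear EAB0.
  unfold N_in in *.
  set (x := x_in c th) in *; set (r := R_in c th) in *.
  set (A := A_in s c th) in *; set (B := B_in s c th) in *.
  set (W := W_in s c t th) in *; set (W0 := W_in 0 c t th) in *.
  set (S := sin th ^ 2) in *; set (C := cos th ^ 2) in *.
  assert (HAB : 0 < A * B) by now apply Rmult_lt_0_compat.
  assert (EAB : (A * B) ^ 2 = (r + 2 * s * x + s ^ 2 * S) * (c ^ 2 * r + 2 * s * x - s ^ 2 * C))
    by (rewrite <- EA, <- EB; ring).
  set (p := A * B) in *.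
  set (N := r * x + 2 * s) in *.
  (* The polynomial [n] is the quotient by [s] of [c^2 N^2 - x^2 p^2], the difference of squares
     that compares [N / p] with [x / c]. *)
  set (n := 4 * c ^ 2 * r * x - 2 * x ^ 3 * r * (1 + c ^ 2)
           + s * (4 * c ^ 2 - x ^ 2 * (4 * x ^ 2 + c ^ 2 * r * S - r * C))
           - s ^ 2 * (2 * x ^ 3 * (S - C)) + s ^ 3 * (x ^ 2 * (S * C))).
  assert (Hden : 0 < c * N + x * p)
    by (apply Rplus_lt_0_compat; apply Rmult_lt_0_compat; lra).
  assert (E1 : N / p = x / c + s * (n / (c * p * (c * N + x * p)))).
  { apply Rminus_diag_uniq.
    replace (N / p - (x / c + s * (n / (c * p * (c * N + x * p)))))
      with ((c ^ 2 * N ^ 2 - x ^ 2 * p ^ 2 - s * n) / (c * p * (c * N + x * p)))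
      by (field; repeat split; lra).
    rewrite EAB; unfold n, N.
    replace (c ^ 2 * (r * x + 2 * s) ^ 2 - _ - _) with 0 by ring.
    unfold Rdiv; ring. }
  assert (E2 : / W = / W0 + s * ((2 * x * S + s * S ^ 2) / (W * W0 * (W + W0)))).
  { apply Rminus_diag_uniq.
    replace (/ W - (/ W0 + s * ((2 * x * S + s * S ^ 2) / (W * W0 * (W + W0)))))
      with ((W0 ^ 2 - W ^ 2 - s * (2 * x * S + s * S ^ 2)) / (W * W0 * (W + W0)))
      by (field; lra).
    rewrite EW, EW0; field; lra. }
  replace ((x - s * C) * (N / (p * W))) with (x * (N / p) * / W - s * C * (N / p) * / W)
    by (field; lra).
  replace ((x - 0 * C) * ((r * x + 2 * 0) / (c * r * W0))) with (x ^ 2 / c * / W0)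
    by (field; lra).
  set (w := (2 * x * S + s * S ^ 2) / (W * W0 * (W + W0))) in *.
  set (e := n / (c * p * (c * N + x * p))) in *.
  rewrite E1.
  replace (/ W0) with (/ W - s * w) by lra.
  unfold Rdiv; ring.
Qed.

(** * Periods as integrals over [0, PI/2] *)

(** Moves the root of the numerator into the denominator. The integrands of [I] and [J] thereby
    become [|z - b|] and [|z + a|] over the common denominator [|w|]. *)
Lemma sqrt_quotient p q r w : 0 < p -> 0 < q -> 0 < r -> 0 < w ->
  sqrt (p / (q * r * w)) = p / (sqrt (p * q) * sqrt r * sqrt w).
Proof.
  intros Hp Hq Hr Hw.
  rewrite <- !sqrt_mult by (repeat apply Rmult_le_pos; lra).
  rewrite <- (sqrt_pow2 p) at 2 by lra.
  rewrite <- sqrt_div_alt by (repeat apply Rmult_lt_0_compat; lra).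
  f_equal; field; lra.
Qed.

Lemma sin_cos_pos th : 0 < th < PI / 2 -> 0 < sin th /\ 0 < cos th.
Proof. intros H; split; [apply sin_gt_0|apply cos_gt_0]; lra. Qed.

Definition z_out (s c t th : R) : R := x_out c t th + s * cos th ^ 2.
Definition z_in (s c th : R) : R := x_in c th + s * sin th ^ 2.

Lemma is_derive_z_out s c t th : 1 < c -> c < t ->
  is_derive (z_out s c t) th (sin th * cos th * (M_out s c t th / x_out c t th)).
Proof.
  intros Hc Ht.
  assert (Hx := x_out_bounds c t th Hc Ht).
  assert (Hs := x_out_sqr c t th).
  unfold z_out, M_out; unfold x_out at 1.
  evar (l : R); replace (sin th * _ * _) with l; [unfold l; auto_derive|].
  - simpl in Hs; nra.
  - reflexivity.
  - unfold l; fold (x_out c t th).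
    change (sqrt _) with (x_out c t th).
    field; lra.
Qed.

Lemma is_derive_z_in s c th : 1 < c ->
  is_derive (z_in s c) th (sin th * cos th * N_in s c th).
Proof.
  intros Hc.
  assert (HD := Delta_in_bounds c th Hc).
  assert (H0 : 0 < sqrt (Delta_in c th)) by (apply sqrt_lt_R0; lra).
  unfold z_in, N_in, x_in, R_in, Delta_in in *.
  evar (l : R); replace (sin th * _ * _) with l; [unfold l; auto_derive|].
  - split; [lra|split; [|exact I]]. simpl in H0. lra.
  - reflexivity.
  - unfold l.
    change (sqrt (c * (c * 1) * (cos th * (cos th * 1)) + sin th * (sin th * 1)))
      with (sqrt (c ^ 2 * cos th ^ 2 + sin th ^ 2)).
    assert (HE : c ^ 2 * cos th ^ 2 + sin th ^ 2 = sqrt (c ^ 2 * cos th ^ 2 + sin th ^ 2) ^ 2)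
      by (symmetry; apply pow2_sqrt; lra).
    set (w := sqrt _) in *; rewrite HE.
    field; lra.
Qed.

(** The endpoint zeros at [b] and [t] appear as the exact factors [sin th] and [cos th], for every
    admissible [s] and not just at [s = 0]. The bounds on [z] are read off from the positivity of
    the two squares. *)
Lemma z_out_facts s c t th : near_diagonal s c t -> 0 < th < PI / 2 ->
  let z := z_out s c t th in
  c + s < z /\ 1 < z /\ z < t /\
  sqrt ((z - (c + s)) * (z + (c - s))) = sin th * A_out s c t th /\
  sqrt (z ^ 2 - 1) = Z_out s c t th /\
  sqrt (t ^ 2 - z ^ 2) = cos th * B_out s c t th.
Proof.
  intros H Hth z; destruct (sin_cos_pos th Hth) as [Sp Cp].
  destruct (radicands_pos s c t th H) as (R1 & R2 & R3 & R4 & _).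
  destruct (near_diagonal_bounds _ _ _ H) as (B1 & B2 & B3 & B4 & B5 & B6 & B7 & B8 & B9 & B10).
  destruct (x_out_bounds c t th B1 B2) as [X1 X2].
  assert (HS := sin2_range th). assert (HC := cos2_sin2 th).
  assert (Hl := Rabs_between s).
  assert (Hsq := x_out_sqr c t th).
  assert (E1 : (z - (c + s)) * (z + (c - s)) = (sin th * A_out s c t th) ^ 2).
  { rewrite Rpow_mult_distr; unfold A_out; rewrite pow2_sqrt by lra.
    unfold z, z_out, M_out; rewrite HC in Hsq |- *.
    set (x := x_out c t th) in *; set (S := sin th ^ 2) in *.
    transitivity (x ^ 2 - c ^ 2 - 2 * s * x * S + s ^ 2 * S ^ 2); [ring|].
    rewrite Hsq; ring. }
  assert (E2 : t ^ 2 - z ^ 2 = (cos th * B_out s c t th) ^ 2).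
  { rewrite Rpow_mult_distr; unfold B_out; rewrite pow2_sqrt by lra.
    unfold z, z_out, M_out; rewrite HC in Hsq |- *.
    set (x := x_out c t th) in *; set (S := sin th ^ 2) in *.
    transitivity (t ^ 2 - x ^ 2 - 2 * s * x * (1 - S) - s ^ 2 * (1 - S) ^ 2); [ring|].
    rewrite Hsq; ring. }
  destruct (factors_out_pos _ _ _ th H) as (P1 & P2 & P3 & P4 & P5).
  assert (Q1 : 0 < sin th * A_out s c t th) by now apply Rmult_lt_0_compat.
  assert (Q2 : 0 < cos th * B_out s c t th) by now apply Rmult_lt_0_compat.
  assert (Hzl : 1 < z).
  { unfold z, z_out. assert (- Rabs s <= s * cos th ^ 2) by (rewrite HC; nra). lra. }
  assert (Hzr : 0 < z + (c - s)) by lra.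
  split; [|split; [exact Hzl|split; [|split; [|split]]]].
  - apply Rnot_le_lt; intros Hn; assert ((z - (c + s)) * (z + (c - s)) <= 0) by nra. nra.
  - assert (0 < t ^ 2 - z ^ 2) by (rewrite E2; now apply pow_lt).
    apply Rnot_le_lt; intros Hn; assert (t ^ 2 <= z ^ 2) by (apply pow_incr; lra); lra.
  - rewrite E1; apply sqrt_pow2; lra.
  - reflexivity.
  - rewrite E2; apply sqrt_pow2; lra.
Qed.

Lemma z_in_facts s c t th : near_diagonal s c t -> 0 < th < PI / 2 ->
  let z := z_in s c th in
  z < c + s /\ 1 < z /\ z < t /\
  sqrt ((c + s - z) * (z + (c - s))) = cos th * B_in s c th /\
  sqrt (z ^ 2 - 1) = sin th * A_in s c th /\
  sqrt (t ^ 2 - z ^ 2) = W_in s c t th.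
Proof.
  intros H Hth z; destruct (sin_cos_pos th Hth) as [Sp Cp].
  destruct (radicands_pos s c t th H) as (_ & _ & _ & _ & R5 & R6 & R7 & R8).
  destruct (near_diagonal_bounds _ _ _ H) as (B1 & B2 & B3 & B4 & B5 & B6 & B7 & B8 & B9 & B10).
  destruct (x_in_bounds c th B1) as [X1 X2].
  destruct (Delta_in_bounds c th B1) as [D1 D2].
  assert (HS := sin2_range th). assert (HC := cos2_sin2 th).
  assert (Hl := Rabs_between s).
  assert (Hsq := x_in_sqr c th B1).
  assert (E1 : (c + s - z) * (z + (c - s)) = (cos th * B_in s c th) ^ 2).
  { rewrite Rpow_mult_distr; unfold B_in; rewrite pow2_sqrt by lra.
    unfold z, z_in; unfold R_in; rewrite HC.
    assert (Hx2 : c ^ 2 - x_in c th ^ 2 = c ^ 2 * ((c ^ 2 - 1) / Delta_in c th) * (1 - sin th ^ 2)).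
    { rewrite Hsq; unfold Delta_in in *; rewrite HC in *; field; lra. }
    set (x := x_in c th) in *; set (S := sin th ^ 2) in *.
    transitivity (c ^ 2 - x ^ 2 + 2 * s * x * (1 - S) - s ^ 2 * (1 - S) ^ 2); [ring|].
    rewrite Hx2; ring. }
  assert (E2 : z ^ 2 - 1 = (sin th * A_in s c th) ^ 2).
  { rewrite Rpow_mult_distr; unfold A_in; rewrite pow2_sqrt by lra.
    unfold z, z_in; unfold R_in.
    assert (Hx2 : x_in c th ^ 2 - 1 = ((c ^ 2 - 1) / Delta_in c th) * sin th ^ 2).
    { rewrite Hsq; unfold Delta_in in *; rewrite HC in *; field; lra. }
    set (x := x_in c th) in *; set (S := sin th ^ 2) in *.
    transitivity (x ^ 2 - 1 + 2 * s * x * S + s ^ 2 * S ^ 2); [ring|].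
    rewrite Hx2; ring. }
  destruct (factors_in_pos _ _ _ th H) as (P1 & P2 & P3 & P4 & P5).
  assert (Q1 : 0 < cos th * B_in s c th) by now apply Rmult_lt_0_compat.
  assert (Q2 : 0 < sin th * A_in s c th) by now apply Rmult_lt_0_compat.
  assert (Hzl : 0 < z).
  { unfold z, z_in. assert (- Rabs s <= s * sin th ^ 2) by nra. lra. }
  assert (Hz1 : 1 < z).
  { assert (0 < z ^ 2 - 1) by (rewrite E2; now apply pow_lt).
    apply Rnot_le_lt; intros Hn; assert (z ^ 2 <= 1 ^ 2) by (apply pow_incr; lra); lra. }
  assert (Hzt : z < t).
  { unfold z, z_in. assert (s * sin th ^ 2 <= Rabs s) by nra. lra. }
  assert (Hzr : 0 < z + (c - s)) by lra.
  split; [|split; [exact Hz1|split; [exact Hzt|split; [|split]]]].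
  - apply Rnot_le_lt; intros Hn; assert ((c + s - z) * (z + (c - s)) <= 0) by nra. nra.
  - rewrite E1; apply sqrt_pow2; lra.
  - rewrite E2; apply sqrt_pow2; lra.
  - reflexivity.
Qed.

Definition f_I (a b t z : R) : R :=
  sqrt (Rabs (z - b) / (Rabs (z + a) * Rabs (z ^ 2 - 1) * Rabs (z ^ 2 - t ^ 2))).
Definition f_J (a b t z : R) : R :=
  sqrt (Rabs (z + a) / (Rabs (z - b) * Rabs (z ^ 2 - 1) * Rabs (z ^ 2 - t ^ 2))).

Lemma cont_f_IJ a b t z : z <> b -> z + a <> 0 -> 1 < z -> z < t ->
  continuous (f_I a b t) z /\ continuous (f_J a b t) z.
Proof.
  intros Hb Ha H1 Ht.
  assert (0 < Rabs (z - b)) by (apply Rabs_pos_lt; lra).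
  assert (0 < Rabs (z + a)) by (apply Rabs_pos_lt; lra).
  assert (0 < Rabs (z ^ 2 - 1)) by (apply Rabs_pos_lt; nra).
  assert (0 < Rabs (z ^ 2 - t ^ 2)) by (apply Rabs_pos_lt; nra).
  split; unfold f_I, f_J; cont;
    apply Rgt_not_eq; repeat apply Rmult_lt_0_compat; assumption.
Qed.

(** Here [z - b = (z - s) - c] and [z + a = (z - s) + c] give the integrands [y - c h] and
    [y + c h]. On the inner interval [b - z = c - (z - s)] is the positive quantity instead, which
    exchanges the roles of [y] and [c h] in the first formula. *)
Lemma is_RInt_gen_outer s c t : near_diagonal s c t ->
  is_RInt_gen (f_I (c - s) (c + s) t) (at_right (c + s)) (at_left t)
    (RInt (fun th => y_out s c t th - c * h_out s c t th) 0 (PI / 2)) /\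
  is_RInt_gen (f_J (c - s) (c + s) t) (at_right (c + s)) (at_left t)
    (RInt (fun th => y_out s c t th + c * h_out s c t th) 0 (PI / 2)).
Proof.
  intros H; assert (HPI := PI_RGT_0).
  assert (Hct := H); destruct Hct as (Hc & Ht & _).
  assert (E0 : c + s = z_out s c t 0).
  { unfold z_out, x_out; rewrite cos_0, sin_0.
    replace (c ^ 2 * 1 ^ 2 + t ^ 2 * 0 ^ 2) with (c ^ 2) by ring.
    rewrite sqrt_pow2 by lra; ring. }
  assert (E1 : t = z_out s c t (PI / 2)).
  { unfold z_out, x_out; rewrite cos_PI2, sin_PI2.
    replace (c ^ 2 * 0 ^ 2 + t ^ 2 * 1 ^ 2) with (t ^ 2) by ring.
    rewrite sqrt_pow2 by lra; ring. }
  assert (Hcy : forall th, continuous (fun v => y_out s c t v) th).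
  { intros th; apply (cont_y_out (fun _ => s) (fun _ => c) (fun _ => t) (fun v => v)); cont. }
  assert (Hch : forall th, continuous (fun v => h_out s c t v) th).
  { intros th; apply (cont_h_out (fun _ => s) (fun _ => c) (fun _ => t) (fun v => v)); cont. }
  assert (Hdz : forall th, continuous (fun v => sin v * cos v * (M_out s c t v / x_out c t v)) th).
  { intros th; destruct (x_out_bounds c t th Hc Ht).
    assert (continuous (fun v => x_out c t v) th)
      by (apply (cont_x_out (fun _ => c) (fun _ => t) (fun v => v)); cont).
    assert (continuous (fun v => M_out s c t v) th)
      by (apply (cont_M_out (fun _ => s) (fun _ => c) (fun _ => t) (fun v => v)); cont).
    cont; lra. }
  assert (Hdp : forall th, 0 < th < PI / 2 -> 0 < sin th * cos th * (M_out s c t th / x_out c t th)).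
  { intros th Hth; destruct (factors_out_pos _ _ _ th H) as (P1 & P2 & _).
    destruct (sin_cos_pos th Hth).
    apply Rmult_lt_0_compat; [now apply Rmult_lt_0_compat|now apply Rdiv_lt_0_compat]. }
  assert (Hfc : forall th, 0 < th < PI / 2 ->
     continuous (f_I (c - s) (c + s) t) (z_out s c t th) /\
     continuous (f_J (c - s) (c + s) t) (z_out s c t th)).
  { intros th Hth; destruct (z_out_facts s c t th H Hth) as (F1 & F2 & F3 & _).
    destruct (near_diagonal_bounds _ _ _ H) as (_ & _ & B3 & _).
    apply cont_f_IJ; lra. }
  rewrite (f_equal at_right E0), (f_equal at_left E1).
  split; apply is_RInt_gen_subst with (phi := z_out s c t) (al := 0) (be := PI / 2) (dphi := fun v => sin v * cos v * (M_out s c t v / x_out c t v));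
    [ lra | exact (fun th => is_derive_z_out s c t th Hc Ht) | exact Hdz | exact Hdp
    | intros th Hth; apply (Hfc th Hth) | intros th; cont; [apply Hcy | apply Hch] |
    | lra | exact (fun th => is_derive_z_out s c t th Hc Ht) | exact Hdz | exact Hdp
    | intros th Hth; apply (Hfc th Hth) | intros th; cont; [apply Hcy | apply Hch] | ].
  all: intros th Hth; destruct (z_out_facts s c t th H Hth) as (F1 & F2 & F3 & F4 & F5 & F6);
    destruct (factors_out_pos _ _ _ th H) as (P1 & P2 & P3 & P4 & P5);
    destruct (sin_cos_pos th Hth);
    assert (Hzs : z_out s c t th - s = x_out c t th - s * sin th ^ 2)
      by (unfold z_out; rewrite cos2_sin2; ring);
    unfold f_I, f_J, y_out; rewrite <- Hzs; set (z := z_out s c t th) in *;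
    destruct (near_diagonal_bounds _ _ _ H) as (_ & _ & B3 & _);
    rewrite (Rabs_pos_eq (z - (c + s))), (Rabs_pos_eq (z + (c - s))), (Rabs_pos_eq (z ^ 2 - 1)),
      (Rabs_left (z ^ 2 - t ^ 2)) by nra;
    replace (- (z ^ 2 - t ^ 2)) with (t ^ 2 - z ^ 2) by ring;
    rewrite sqrt_quotient by nra;
    rewrite ?(Rmult_comm (z + (c - s)) (z - (c + s))), F4, F5, F6;
    unfold h_out; field; lra.
Qed.

Lemma is_RInt_gen_inner s c t : near_diagonal s c t ->
  is_RInt_gen (f_I (c - s) (c + s) t) (at_right 1) (at_left (c + s))
    (RInt (fun th => c * h_in s c t th - y_in s c t th) 0 (PI / 2)) /\
  is_RInt_gen (f_J (c - s) (c + s) t) (at_right 1) (at_left (c + s))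
    (RInt (fun th => c * h_in s c t th + y_in s c t th) 0 (PI / 2)).
Proof.
  intros H; assert (HPI := PI_RGT_0).
  assert (Hct := H); destruct Hct as (Hc & Ht & _).
  assert (E0 : 1 = z_in s c 0).
  { unfold z_in, x_in, Delta_in; rewrite cos_0, sin_0.
    replace (c ^ 2 * 1 ^ 2 + 0 ^ 2) with (c ^ 2) by ring.
    rewrite sqrt_pow2 by lra; field; lra. }
  assert (E1 : c + s = z_in s c (PI / 2)).
  { unfold z_in, x_in, Delta_in; rewrite cos_PI2, sin_PI2.
    replace (c ^ 2 * 0 ^ 2 + 1 ^ 2) with 1 by ring.
    rewrite sqrt_1; field. }
  assert (Hcy : forall th, continuous (fun v => y_in s c t v) th).
  { intros th; apply (cont_y_in (fun _ => s) (fun _ => c) (fun _ => t) (fun v => v)); cont. }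
  assert (Hch : forall th, continuous (fun v => h_in s c t v) th).
  { intros th; apply (cont_h_in (fun _ => s) (fun _ => c) (fun _ => t) (fun v => v)); cont. }
  assert (Hdz : forall th, continuous (fun v => sin v * cos v * N_in s c v) th).
  { intros th.
    assert (continuous (fun v => N_in s c v) th)
      by (apply (cont_N_in (fun _ => s) (fun _ => c) (fun _ => t) (fun v => v)); cont).
    cont. }
  assert (Hdp : forall th, 0 < th < PI / 2 -> 0 < sin th * cos th * N_in s c th).
  { intros th Hth; destruct (factors_in_pos _ _ _ th H) as (P1 & P2 & _).
    destruct (sin_cos_pos th Hth).
    repeat apply Rmult_lt_0_compat; assumption. }
  assert (Hfc : forall th, 0 < th < PI / 2 ->
     continuous (f_I (c - s) (c + s) t) (z_in s c th) /\
     continuous (f_J (c - s) (c + s) t) (z_in s c th)).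
  { intros th Hth; destruct (z_in_facts s c t th H Hth) as (F1 & F2 & F3 & _).
    destruct (near_diagonal_bounds _ _ _ H) as (_ & _ & B3 & _).
    apply cont_f_IJ; lra. }
  rewrite (f_equal at_right E0), (f_equal at_left E1).
  split; apply is_RInt_gen_subst with (phi := z_in s c) (al := 0) (be := PI / 2) (dphi := fun v => sin v * cos v * N_in s c v);
    [ lra | exact (fun th => is_derive_z_in s c th Hc) | exact Hdz | exact Hdp
    | intros th Hth; apply (Hfc th Hth) | intros th; cont; [apply Hch | apply Hcy] |
    | lra | exact (fun th => is_derive_z_in s c th Hc) | exact Hdz | exact Hdp
    | intros th Hth; apply (Hfc th Hth) | intros th; cont; [apply Hch | apply Hcy] | ].
  all: intros th Hth; destruct (z_in_facts s c t th H Hth) as (F1 & F2 & F3 & F4 & F5 & F6);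
    destruct (factors_in_pos _ _ _ th H) as (P1 & P2 & P3 & P4 & P5);
    destruct (sin_cos_pos th Hth);
    assert (Hzs : z_in s c th - s = x_in c th - s * cos th ^ 2)
      by (unfold z_in; rewrite cos2_sin2; ring);
    unfold f_I, f_J, y_in; rewrite <- Hzs; set (z := z_in s c th) in *;
    destruct (near_diagonal_bounds _ _ _ H) as (_ & _ & B3 & _);
    rewrite (Rabs_left (z - (c + s))), (Rabs_pos_eq (z + (c - s))), (Rabs_pos_eq (z ^ 2 - 1)),
      (Rabs_left (z ^ 2 - t ^ 2)) by nra;
    replace (- (z ^ 2 - t ^ 2)) with (t ^ 2 - z ^ 2) by ring;
    replace (- (z - (c + s))) with (c + s - z) by ring;
    rewrite sqrt_quotient by nra;
    rewrite ?(Rmult_comm (z + (c - s)) (c + s - z)), F4, F5, F6;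
    unfold h_in; field; lra.
Qed.

(** * Factorization of Q *)

Definition int_h_out (s c t : R) : R := RInt (fun th => h_out s c t th) 0 (PI / 2).
Definition int_y_out (s c t : R) : R := RInt (fun th => y_out s c t th) 0 (PI / 2).
Definition int_h_in (s c t : R) : R := RInt (fun th => h_in s c t th) 0 (PI / 2).
Definition int_y_in (s c t : R) : R := RInt (fun th => y_in s c t th) 0 (PI / 2).
Definition int_h_out_slope (s c t : R) : R :=
  RInt (fun th => h_out_slope s c t th) 0 (PI / 2).
Definition int_y_in_slope (s c t : R) : R :=
  RInt (fun th => y_in_slope s c t th) 0 (PI / 2).

(** Half of the cross-multiplied numerator of [Q], divided by [s]. The sums over [s] and [- s] of
    the slopes are what is left of the differences of [int_h_out] and [int_y_in], whose values at
    [s = 0] cancel. *)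
Definition gap (s c t : R) : R :=
  (int_y_out s c t + int_y_out (- s) c t) * (int_y_in_slope s c t + int_y_in_slope (- s) c t)
  - c ^ 2 * (int_h_out_slope s c t + int_h_out_slope (- s) c t)
    * (int_h_in s c t + int_h_in (- s) c t).

Section IntegrandContinuityInAngle.

Context (s c t : R) (Hnear : near_diagonal s c t) (th : R).

Lemma cont_th_h_out : continuous (fun v => h_out s c t v) th.
Proof. apply (cont_h_out (fun _ => s) (fun _ => c) (fun _ => t) (fun v => v)); cont. Qed.

Lemma cont_th_y_out : continuous (fun v => y_out s c t v) th.
Proof. apply (cont_y_out (fun _ => s) (fun _ => c) (fun _ => t) (fun v => v)); cont. Qed.

Lemma cont_th_h_in : continuous (fun v => h_in s c t v) th.
Proof. apply (cont_h_in (fun _ => s) (fun _ => c) (fun _ => t) (fun v => v)); cont. Qed.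

Lemma cont_th_y_in : continuous (fun v => y_in s c t v) th.
Proof. apply (cont_y_in (fun _ => s) (fun _ => c) (fun _ => t) (fun v => v)); cont. Qed.

Lemma cont_th_h_out_slope : continuous (fun v => h_out_slope s c t v) th.
Proof. apply (cont_h_out_slope (fun _ => s) (fun _ => c) (fun _ => t) (fun v => v)); cont. Qed.

Lemma cont_th_y_in_slope : continuous (fun v => y_in_slope s c t v) th.
Proof. apply (cont_y_in_slope (fun _ => s) (fun _ => c) (fun _ => t) (fun v => v)); cont. Qed.

Lemma cont_th_h_out_scal : continuous (fun v => c * h_out s c t v) th.
Proof. apply (cont_mul (fun _ => c)); [apply continuous_const|apply cont_th_h_out]. Qed.

Lemma cont_th_h_in_scal : continuous (fun v => c * h_in s c t v) th.
Proof. apply (cont_mul (fun _ => c)); [apply continuous_const|apply cont_th_h_in]. Qed.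

End IntegrandContinuityInAngle.

Lemma int_h_out_expand s c t : near_diagonal s c t ->
  int_h_out s c t = int_h_out 0 c t + s * int_h_out_slope s c t.
Proof.
  intros H; assert (H0 := near_diagonal_center _ _ _ H).
  unfold int_h_out, int_h_out_slope.
  rewrite <- RInt_mulc by (intros th; now apply cont_th_h_out_slope).
  rewrite <- RInt_add.
  - apply RInt_eq; intros th; now apply h_out_expand.
  - intros th; now apply cont_th_h_out.
  - intros th; apply (cont_mul (fun _ => s)); [apply continuous_const|now apply cont_th_h_out_slope].
Qed.

Lemma int_y_in_expand s c t : near_diagonal s c t ->
  int_y_in s c t = int_y_in 0 c t + s * int_y_in_slope s c t.
Proof.
  intros H; assert (H0 := near_diagonal_center _ _ _ H).
  unfold int_y_in, int_y_in_slope.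
  rewrite <- RInt_mulc by (intros th; now apply cont_th_y_in_slope).
  rewrite <- RInt_add.
  - apply RInt_eq; intros th; now apply y_in_expand.
  - intros th; now apply cont_th_y_in.
  - intros th; apply (cont_mul (fun _ => s)); [apply continuous_const|now apply cont_th_y_in_slope].
Qed.

Lemma improper_outer s c t : near_diagonal s c t ->
  improper_RInt (f_I (c - s) (c + s) t) (c + s) t = int_y_out s c t - c * int_h_out s c t /\
  improper_RInt (f_J (c - s) (c + s) t) (c + s) t = int_y_out s c t + c * int_h_out s c t.
Proof.
  intros H; destruct (is_RInt_gen_outer s c t H) as [H1 H2].
  unfold improper_RInt, int_y_out, int_h_out.
  rewrite <- RInt_mulc by (intros th; now apply cont_th_h_out).
  rewrite <- (RInt_sub _ _ _ _ (cont_th_y_out s c t H) (cont_th_h_out_scal s c t H)), <- (RInt_add _ _ _ _ (cont_th_y_out s c t H) (cont_th_h_out_scal s c t H)).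
  split; now apply is_RInt_gen_unique.
Qed.

Lemma improper_inner s c t : near_diagonal s c t ->
  improper_RInt (f_I (c - s) (c + s) t) 1 (c + s) = c * int_h_in s c t - int_y_in s c t /\
  improper_RInt (f_J (c - s) (c + s) t) 1 (c + s) = c * int_h_in s c t + int_y_in s c t.
Proof.
  intros H; destruct (is_RInt_gen_inner s c t H) as [H1 H2].
  unfold improper_RInt, int_y_in, int_h_in.
  rewrite <- RInt_mulc by (intros th; now apply cont_th_h_in).
  rewrite <- (RInt_sub _ _ _ _ (cont_th_h_in_scal s c t H) (cont_th_y_in s c t H)), <- (RInt_add _ _ _ _ (cont_th_h_in_scal s c t H) (cont_th_y_in s c t H)).
  split; now apply is_RInt_gen_unique.
Qed.

Lemma f_I_opp a b t z : f_I a b t (- z) = f_J b a t z.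
Proof.
  unfold f_I, f_J.
  rewrite <- (Rabs_Ropp (- z - b)), <- (Rabs_Ropp (- z + a)).
  replace (- (- z - b)) with (z + b) by ring; replace (- (- z + a)) with (z - a) by ring.
  replace ((- z) ^ 2) with (z ^ 2) by ring; reflexivity.
Qed.

Lemma f_J_opp a b t z : f_J a b t (- z) = f_I b a t z.
Proof. rewrite <- (Ropp_involutive z) at 2; now rewrite f_I_opp. Qed.

Lemma is_RInt_gen_reflect (f g : R -> R) (x y l : R) :
  (forall z, f (- z) = g z) ->
  is_RInt_gen g (at_right x) (at_left y) l ->
  improper_RInt f (- y) (- x) = l.
Proof.
  intros Hfg H; apply is_RInt_gen_unique, is_RInt_gen_opp_var.
  intros P HP; destruct (H P HP) as [P1 P2 A B AB].
  exists P1 P2; auto.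
  intros u v Hu Hv; destruct (AB u v Hu Hv) as [k [Hk Pk]]; exists k; split; [|exact Pk].
  eapply is_RInt_ext; [|exact Hk]; intros; now rewrite Hfg.
Qed.

Lemma periods s c t : near_diagonal s c t ->
  let a := c - s in let b := c + s in
  period_I a b t 1 = int_y_out (- s) c t + c * int_h_out (- s) c t /\
  period_I a b t 2 = c * int_h_in (- s) c t + int_y_in (- s) c t /\
  period_I a b t 4 = c * int_h_in s c t - int_y_in s c t /\
  period_I a b t 5 = int_y_out s c t - c * int_h_out s c t /\
  period_J a b t 1 = int_y_out (- s) c t - c * int_h_out (- s) c t /\
  period_J a b t 2 = c * int_h_in (- s) c t - int_y_in (- s) c t /\
  period_J a b t 4 = c * int_h_in s c t + int_y_in s c t /\
  period_J a b t 5 = int_y_out s c t + c * int_h_out s c t.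
Proof.
  intros H a b; assert (H' := near_diagonal_opp _ _ _ H).
  destruct (improper_outer s c t H) as [A1 A2].
  destruct (improper_inner s c t H) as [A3 A4].
  destruct (improper_outer _ c t H') as [B1 B2].
  destruct (improper_inner _ c t H') as [B3 B4].
  destruct (is_RInt_gen_outer _ c t H') as [C1 C2].
  destruct (is_RInt_gen_inner _ c t H') as [C3 C4].
  assert (D1 := is_RInt_gen_unique (V := R_CompleteNormedModule) _ _ C1).
  assert (D2 := is_RInt_gen_unique (V := R_CompleteNormedModule) _ _ C2).
  assert (D3 := is_RInt_gen_unique (V := R_CompleteNormedModule) _ _ C3).
  assert (D4 := is_RInt_gen_unique (V := R_CompleteNormedModule) _ _ C4).
  replace (c - - s) with b in * by (unfold b; ring).
  replace (c + - s) with a in * by (unfold a; ring).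
  fold a in A1, A2, A3, A4; fold b in A1, A2, A3, A4.
  repeat split.
  - rewrite <- B2; unfold improper_RInt; rewrite D2.
    exact (is_RInt_gen_reflect (f_I a b t) _ _ _ _ (f_I_opp a b t) C2).
  - rewrite <- B4; unfold improper_RInt; rewrite D4.
    exact (is_RInt_gen_reflect (f_I a b t) _ _ _ _ (f_I_opp a b t) C4).
  - exact A3.
  - exact A1.
  - rewrite <- B1; unfold improper_RInt; rewrite D1.
    exact (is_RInt_gen_reflect (f_J a b t) _ _ _ _ (f_J_opp a b t) C1).
  - rewrite <- B3; unfold improper_RInt; rewrite D3.
    exact (is_RInt_gen_reflect (f_J a b t) _ _ _ _ (f_J_opp a b t) C3).
  - exact A4.
  - exact A2.
Qed.

(** The integrands are [(b - z) h] and [(z + a) h] with [1 < z < b]. This makes both denominators of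
    [Q] positive. *)
Lemma int_in_pos s c t : near_diagonal s c t ->
  0 < c * int_h_in s c t - int_y_in s c t /\ 0 < c * int_h_in s c t + int_y_in s c t.
Proof.
  intros H; assert (HPI := PI_RGT_0).
  unfold int_y_in, int_h_in.
  rewrite <- RInt_mulc by (intros th; now apply cont_th_h_in).
  assert (Hy : forall th, continuous (fun v => y_in s c t v) th)
    by (intros th; now apply cont_th_y_in).
  assert (Hh : forall th, continuous (fun v => c * h_in s c t v) th)
    by (intros th; apply (cont_mul (fun _ => c)); [apply continuous_const|now apply cont_th_h_in]).
  rewrite <- RInt_sub, <- RInt_add by assumption.
  assert (Hpos : forall th, 0 < th < PI / 2 ->
    0 < c * h_in s c t th - y_in s c t th /\ 0 < c * h_in s c t th + y_in s c t th).
  { intros th Hth; destruct (z_in_facts s c t th H Hth) as (F1 & F2 & _).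
    destruct (near_diagonal_bounds _ _ _ H) as (_ & _ & B3 & _).
    destruct (factors_in_pos _ _ _ th H) as (P1 & P2 & P3 & P4 & P5).
    assert (0 < h_in s c t th).
    { apply Rdiv_lt_0_compat; repeat apply Rmult_lt_0_compat; assumption. }
    assert (Hzs : z_in s c th - s = x_in c th - s * cos th ^ 2)
      by (unfold z_in; rewrite cos2_sin2; ring).
    unfold y_in; rewrite <- Hzs; split; nra. }
  split; apply RInt_gt_0; try lra.
  - intros th Hth; now apply Hpos.
  - intros th _; now apply (cont_sub (fun v => c * h_in s c t v)).
  - intros th Hth; now apply Hpos.
  - intros th _; now apply (cont_add (fun v => c * h_in s c t v)).
Qed.

(** The factor is left existential because only zeros of [Q] matter later; it is 2 over the product
    of the two denominators. With [s = 0] allowed, the formula also gives the vanishing of [Q] on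
    the diagonal. *)
Lemma Q_gap s c t : near_diagonal s c t ->
  exists k, 0 < k /\ Q (c - s) (c + s) t = k * (s * gap s c t).
Proof.
  intros H; assert (H' := near_diagonal_opp _ _ _ H).
  destruct (periods s c t H) as (I1 & I2 & I4 & I5 & J1 & J2 & J4 & J5).
  destruct (int_in_pos s c t H) as [P1 P2].
  destruct (int_in_pos _ c t H') as [P3 P4].
  assert (E1 := int_h_out_expand s c t H); assert (E2 := int_h_out_expand _ c t H').
  assert (E3 := int_y_in_expand s c t H); assert (E4 := int_y_in_expand _ c t H').
  unfold Q; rewrite I1, I2, I4, I5, J1, J2, J4, J5; unfold gap.
  exists (2 / ((c * int_h_in (- s) c t + int_y_in (- s) c t + (c * int_h_in s c t - int_y_in s c t))
    * (c * int_h_in (- s) c t - int_y_in (- s) c t + (c * int_h_in s c t + int_y_in s c t)))).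
  split.
  - apply Rdiv_lt_0_compat; [lra|apply Rmult_lt_0_compat; lra].
  - set (HI := int_h_in s c t) in *; set (HI' := int_h_in (- s) c t) in *.
    set (DI := c * HI' + int_y_in (- s) c t + (c * HI - int_y_in s c t)).
    set (DJ := c * HI' - int_y_in (- s) c t + (c * HI + int_y_in s c t)).
    assert (0 < DI) by (unfold DI; lra). assert (0 < DJ) by (unfold DJ; lra).
    assert (EN :
      (int_y_out (- s) c t + c * int_h_out (- s) c t + (int_y_out s c t - c * int_h_out s c t)) * DJ
      - (int_y_out (- s) c t - c * int_h_out (- s) c t + (int_y_out s c t + c * int_h_out s c t)) * DI
      = 2 * (s * gap s c t)).
    { unfold gap, DI, DJ; fold HI HI'; rewrite E1, E2, E3, E4; ring. }
    unfold gap in EN; fold HI HI' in EN.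
    replace (2 / (DI * DJ) * _) with (2 * (s * gap s c t) / (DI * DJ)) by (unfold gap; fold HI HI'; field; lra).
    unfold gap; fold HI HI'; rewrite <- EN; field; lra.
Qed.

(** * Joint continuity of [gap] *)

Lemma near_diagonal_open s0 c0 t0 : near_diagonal s0 c0 t0 ->
  locally (T := prod_UniformSpace (prod_UniformSpace R_UniformSpace R_UniformSpace) R_UniformSpace)
    (s0, c0, t0) (fun p => near_diagonal (fst (fst p)) (snd (fst p)) (snd p)).
Proof.
  intros (H1 & H2 & H3 & H4).
  set (U := prod_UniformSpace (prod_UniformSpace R_UniformSpace R_UniformSpace) R_UniformSpace).
  assert (Cs : continuous (fun p : U => fst (fst p)) (s0, c0, t0)).
  { apply (continuous_comp (U := U) fst fst); apply continuous_fst. }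
  assert (Cc : continuous (fun p : U => snd (fst p)) (s0, c0, t0)).
  { apply (continuous_comp (U := U) fst snd); [apply continuous_fst|apply continuous_snd]. }
  assert (Ct : continuous (fun p : U => snd p) (s0, c0, t0)) by apply continuous_snd.
  assert (Hlt : forall f g : U -> R, continuous f (s0, c0, t0) -> continuous g (s0, c0, t0) ->
    f (s0, c0, t0) < g (s0, c0, t0) -> locally (s0, c0, t0) (fun p => f p < g p)).
  { intros f g Hf Hg Hfg.
    assert (Hd : continuous (fun p => g p - f p) (s0, c0, t0)) by now apply cont_sub.
    apply filter_imp with (P := fun p => 0 < g p - f p); [intros p Hp; lra|].
    exact (Hd (fun y => 0 < y) (open_gt 0 _ (proj2 (Rlt_0_minus _ _) Hfg))). }
  repeat apply filter_and; apply Hlt; try (cont; fail); simpl; assumption.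
Qed.

Lemma continuous_triple {U : UniformSpace} (s c t : U -> R) (u : U) :
  continuous s u -> continuous c u -> continuous t u ->
  continuous (fun v => (s v, c v, t v) :
    prod_UniformSpace (prod_UniformSpace R_UniformSpace R_UniformSpace) R_UniformSpace) u.
Proof.
  intros Hs Hc Ht P [d Hd]; unfold filtermap.
  apply filter_imp with (P := fun v => ball (s u) d (s v) /\ ball (c u) d (c v) /\ ball (t u) d (t v)).
  - intros v (Q1 & Q2 & Q3); apply Hd; repeat split; assumption.
  - repeat apply filter_and;
      [exact (Hs _ (locally_ball _ d))|exact (Hc _ (locally_ball _ d))|exact (Ht _ (locally_ball _ d))].
Qed.

Lemma continuous_gap {U : UniformSpace} (s c t : U -> R) (u : U) :
  continuous s u -> continuous c u -> continuous t u ->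
  near_diagonal (s u) (c u) (t u) ->
  continuous (fun v => gap (s v) (c v) (t v)) u.
Proof.
  intros Hs Hc Ht H.
  set (V := prod_UniformSpace (prod_UniformSpace R_UniformSpace R_UniformSpace) R_UniformSpace).
  (* The map [s'] is kept apart from [s] because [gap] evaluates each integral at [s] and at [- s].
     The hypothesis on [q] ranges over all uniform spaces: it is used once in the angle with fixed
     parameters, and once on the product of angle and parameters. *)
  assert (Hint : forall (q : R -> R -> R -> R -> R) (s' : U -> R),
    (forall (W : UniformSpace) (s c t th : W -> R) (w : W),
       continuous s w -> continuous c w -> continuous t w -> continuous th w ->
       near_diagonal (s w) (c w) (t w) ->
       continuous (fun v => q (s v) (c v) (t v) (th v)) w) ->
    continuous s' u -> near_diagonal (s' u) (c u) (t u) ->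
    continuous (fun v => RInt (fun th => q (s' v) (c v) (t v) th) 0 (PI / 2)) u).
  { intros q s' Hq Hs' H'.
    apply (continuous_comp (fun v => (s' v, c v, t v) : V)
      (fun p : V => RInt (fun th => q (fst (fst p)) (snd (fst p)) (snd p) th) 0 (PI / 2)));
      [now apply continuous_triple|].
    apply (continuous_RInt_param (fun th (p : V) => q (fst (fst p)) (snd (fst p)) (snd p) th)).
    - generalize PI_RGT_0; lra.
    - generalize (near_diagonal_open _ _ _ H'); apply filter_imp; intros p Hp th.
      apply (Hq _ (fun _ => fst (fst p)) (fun _ => snd (fst p)) (fun _ => snd p) (fun v => v)); cont.
    - intros th _.
      set (W := prod_UniformSpace R_UniformSpace V).
      apply (Hq W (fun w => fst (fst (snd w))) (fun w => snd (fst (snd w)))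
        (fun w => snd (snd w)) (fun w => fst w)); [| | | |exact H'].
      + apply (continuous_comp (U := W) snd (fun p : V => fst (fst p))); [apply continuous_snd|].
        apply (continuous_comp (U := V) fst fst); apply continuous_fst.
      + apply (continuous_comp (U := W) snd (fun p : V => snd (fst p))); [apply continuous_snd|].
        apply (continuous_comp (U := V) fst snd); [apply continuous_fst|apply continuous_snd].
      + apply (continuous_comp (U := W) snd (fun p : V => snd p)); apply continuous_snd.
      + apply continuous_fst. }
  assert (Hs' : continuous (fun v => - s v) u) by now apply cont_opp.
  assert (H' : near_diagonal (- s u) (c u) (t u)) by now apply near_diagonal_opp.
  unfold gap, int_y_out, int_y_in_slope, int_h_out_slope, int_h_in.
  assert (A1 := Hint y_out s (@cont_y_out) Hs H).
  assert (A2 := Hint y_out _ (@cont_y_out) Hs' H').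
  assert (A3 := Hint y_in_slope s (@cont_y_in_slope) Hs H).
  assert (A4 := Hint y_in_slope _ (@cont_y_in_slope) Hs' H').
  assert (A5 := Hint h_out_slope s (@cont_h_out_slope) Hs H).
  assert (A6 := Hint h_out_slope _ (@cont_h_out_slope) Hs' H').
  assert (A7 := Hint h_in s (@cont_h_in) Hs H).
  assert (A8 := Hint h_in _ (@cont_h_in) Hs' H').
  apply cont_sub; [apply cont_mul; apply cont_add; assumption|].
  apply cont_mul; [apply cont_mul; [now apply cont_pow|]|]; apply cont_add; assumption.
Qed.

(** * Elliptic integrals on the diagonal *)

(** Jacobi's delta amplitude with parameter [m]. *)
Definition delta (m th : R) : R := sqrt (1 - m * sin th ^ 2).

Lemma delta_sqr_pos m th : m < 1 -> 0 < 1 - m * sin th ^ 2.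
Proof. intros H; destruct (sin2_range th), (Rle_dec m 0); nra. Qed.

Lemma delta_pos m th : m < 1 -> 0 < delta m th.
Proof. intros H; now apply sqrt_lt_R0, delta_sqr_pos. Qed.

Lemma delta_sqr m th : m < 1 -> delta m th ^ 2 = 1 - m * sin th ^ 2.
Proof. intros H; apply pow2_sqrt, Rlt_le; now apply delta_sqr_pos. Qed.

Lemma cont_delta m th : continuous (fun v => delta m v) th.
Proof.
  assert (continuous (fun v : R => v) th) by apply continuous_id.
  unfold delta; cont.
Qed.

Lemma ellK_delta m : ellK m = RInt (fun th => / delta m th) 0 (PI / 2).
Proof. apply RInt_eq; intros th; unfold delta, Rdiv; now rewrite Rmult_1_l. Qed.

Lemma cont_inv_delta m th : m < 1 -> continuous (fun v => / delta m v) th.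
Proof.
  intros H; apply (continuous_comp (fun v => delta m v) Rinv); [apply cont_delta|].
  apply continuous_Rinv, Rgt_not_eq; now apply delta_pos.
Qed.

(** Substitute [sin^2 = (1 - delta^2) / m]. *)
Lemma RInt_sin2_delta m : 0 < m < 1 ->
  RInt (fun th => sin th ^ 2 / delta m th) 0 (PI / 2) = (ellK m - ellE m) / m.
Proof.
  intros Hm; rewrite ellK_delta.
  change (ellE m) with (RInt (fun th => delta m th) 0 (PI / 2)).
  assert (Hi := fun th => cont_inv_delta m th (proj2 Hm)).
  rewrite <- (RInt_sub _ _ _ _ Hi (cont_delta m)).
  transitivity (/ m * RInt (fun th => / delta m th - delta m th) 0 (PI / 2));
    [|eq_R; unfold Rdiv; ring].
  rewrite <- RInt_mulc
    by (intros th; exact (cont_sub _ _ _ (Hi th) (cont_delta m th))).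
  apply RInt_eq; intros th.
  assert (Hd := delta_pos m th (proj2 Hm)).
  assert (Hs := delta_sqr m th (proj2 Hm)).
  replace (sin th ^ 2) with ((1 - delta m th ^ 2) / m) by (rewrite Hs; field; lra).
  field; lra.
Qed.

(* The boundary values of [sin cos / delta] vanish, and [(1 - m) / delta^3] is
   [delta - m (sin cos / delta)']. *)
Lemma RInt_sin2_delta3 m : 0 < m < 1 ->
  RInt (fun th => sin th ^ 2 / delta m th ^ 3) 0 (PI / 2)
  = (ellE m - (1 - m) * ellK m) / (m * (1 - m)).
Proof.
  intros Hm; rewrite ellK_delta.
  change (ellE m) with (RInt (fun th => delta m th) 0 (PI / 2)).
  set (D := fun th => (cos th ^ 2 - sin th ^ 2) / delta m th
                      + m * (sin th ^ 2 * cos th ^ 2) / delta m th ^ 3).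
  assert (HcD : forall th, continuous D th).
  { intros th; assert (Hd := delta_pos m th (proj2 Hm)).
    assert (continuous (fun v : R => v) th) by apply continuous_id.
    assert (continuous (fun v => delta m v) th) by apply cont_delta.
    unfold D; cont; apply Rgt_not_eq; [assumption|now apply pow_lt]. }
  assert (HD : RInt D 0 (PI / 2) = 0).
  { apply (is_RInt_unique (V := R_CompleteNormedModule)).
    replace 0 with (minus (sin (PI / 2) * cos (PI / 2) / delta m (PI / 2))
                          (sin 0 * cos 0 / delta m 0)) at 2.
    - apply (is_RInt_derive (V := R_CompleteNormedModule)
        (fun th => sin th * cos th / delta m th) D); [|intros; apply HcD].
      intros th _; unfold D.
      assert (Hd := delta_pos m th (proj2 Hm)).
      assert (Hs := delta_sqr m th (proj2 Hm)).
      assert (Hp := delta_sqr_pos m th (proj2 Hm)).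
      unfold delta at 1; evar (l : R); replace (_ + _) with l; [unfold l; auto_derive|].
      + simpl in Hp. split; [lra|split; [|exact I]].
        apply Rgt_not_eq, sqrt_lt_R0; lra.
      + reflexivity.
      + unfold l; replace (sqrt _) with (delta m th) by (unfold delta; f_equal; ring).
        field; lra.
    - rewrite cos_PI2, sin_0; unfold minus, plus, opp; simpl.
      unfold Rdiv; ring. }
  transitivity (/ (m * (1 - m)) * (RInt (fun th => delta m th) 0 (PI / 2)
     - (1 - m) * RInt (fun th => / delta m th) 0 (PI / 2) - m * RInt D 0 (PI / 2)));
    [|rewrite HD; eq_R; field; lra].
  assert (A1 : forall th, continuous (fun v => (1 - m) * / delta m v) th)
    by (intros th; apply (cont_mul (fun _ => 1 - m)); [apply continuous_const|now apply cont_inv_delta]).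
  assert (A2 : forall th, continuous (fun v => m * D v) th)
    by (intros th; apply (cont_mul (fun _ => m)); [apply continuous_const|apply HcD]).
  assert (A3 := fun th => cont_sub _ _ _ (cont_delta m th) (A1 th)).
  rewrite <- (RInt_mulc _ _ _ _ (fun th => cont_inv_delta m th (proj2 Hm))).
  rewrite <- (RInt_mulc D _ _ _ HcD).
  rewrite <- (RInt_sub _ _ _ _ (cont_delta m) A1).
  rewrite <- (RInt_sub _ _ _ _ A3 A2).
  rewrite <- (RInt_mulc _ _ _ _ (fun th => cont_sub _ _ _ (A3 th) (A2 th))).
  apply RInt_eq; intros th; unfold D; rewrite cos2_sin2.
  assert (Hd := delta_pos m th (proj2 Hm)).
  assert (Hs := delta_sqr m th (proj2 Hm)).
  set (d := delta m th) in *.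
  replace (sin th ^ 2) with ((1 - d ^ 2) / m) by (rewrite Hs; field; lra).
  field; lra.
Qed.

Lemma m1_range c t : 1 < c -> c < t -> 0 < m1 c t < 1.
Proof.
  intros Hc Ht; unfold m1; split.
  - apply Rdiv_lt_0_compat; nra.
  - apply (Rmult_lt_reg_r (t ^ 2 - 1)); [nra|]; field_simplify; nra.
Qed.

Lemma m2_range c t : 1 < c -> c < t -> 0 < m2 c t < 1.
Proof.
  intros Hc Ht; unfold m2; split.
  - apply Rmult_lt_0_compat; apply Rdiv_lt_0_compat; nra.
  - assert (0 < c ^ 2 * (t ^ 2 - 1)) by (apply Rmult_lt_0_compat; nra).
    apply (Rmult_lt_reg_r (c ^ 2 * (t ^ 2 - 1))); [assumption|].
    replace (t ^ 2 / c ^ 2 * ((c ^ 2 - 1) / (t ^ 2 - 1)) * (c ^ 2 * (t ^ 2 - 1)))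
      with (t ^ 2 * (c ^ 2 - 1)) by (field; split; nra).
    nra.
Qed.

(** From [x_out^2 - 1 = (t^2 - 1) - (t^2 - c^2) cos^2]. The cosine forces the reflected angle, and
    [(t^2 - c^2) / (t^2 - 1) = 1 - m1] is why the outer integrals give the associated functions
    [ellK_bar] and [ellE_bar]. *)
Lemma Z_out_delta c t th : 1 < c -> c < t ->
  Z_out 0 c t th = sqrt (t ^ 2 - 1) * delta (1 - m1 c t) (PI / 2 - th).
Proof.
  intros Hc Ht; unfold Z_out, delta.
  rewrite sin_shift, <- sqrt_mult_alt by nra; f_equal.
  rewrite Rmult_0_l, Rplus_0_r, x_out_sqr; unfold m1.
  replace (sin th ^ 2) with (1 - cos th ^ 2) by (rewrite cos2_sin2; ring).
  field; nra.
Qed.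

(** From [t^2 - x_in^2 = x_in^2 (t^2 Delta_in / c^2 - 1)], whose last factor is
    [(t^2 - 1) (1 - m2 sin^2)]; this is the origin of [m2]. *)
Lemma W_in_delta c t th : 1 < c -> c < t ->
  W_in 0 c t th = x_in c th * sqrt (t ^ 2 - 1) * delta (m2 c t) th.
Proof.
  intros Hc Ht; unfold W_in, delta.
  destruct (x_in_bounds c th Hc); destruct (Delta_in_bounds c th Hc).
  rewrite <- (sqrt_pow2 (x_in c th)) at 2 by lra.
  rewrite <- sqrt_mult_alt by apply pow2_ge_0.
  rewrite <- sqrt_mult_alt by (apply Rmult_le_pos; [apply pow2_ge_0|nra]); f_equal.
  rewrite Rmult_0_l, Rplus_0_r, x_in_sqr by assumption; unfold m2.
  unfold Delta_in in *; rewrite cos2_sin2 in *.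
  field; repeat split; nra.
Qed.

Lemma A_B_out_center c t th : 1 < c -> c < t ->
  A_out 0 c t th * B_out 0 c t th = t ^ 2 - c ^ 2 /\ M_out 0 c t th = t ^ 2 - c ^ 2.
Proof.
  intros Hc Ht.
  assert (HM : M_out 0 c t th = t ^ 2 - c ^ 2) by (unfold M_out; ring).
  split; [|exact HM]; unfold A_out, B_out; rewrite HM, <- sqrt_mult by nra.
  replace ((t ^ 2 - c ^ 2 + 0 ^ 2 * sin th ^ 2) * (t ^ 2 - c ^ 2 - 0 ^ 2 * cos th ^ 2))
    with ((t ^ 2 - c ^ 2) ^ 2) by ring.
  apply sqrt_pow2; nra.
Qed.

Lemma R_in_pos c th : 1 < c -> 0 < R_in c th.
Proof.
  intros Hc; destruct (Delta_in_bounds c th Hc); apply Rdiv_lt_0_compat; nra.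
Qed.

Lemma A_B_in_center c th : 1 < c ->
  A_in 0 c th * B_in 0 c th = c * R_in c th /\ N_in 0 c th = R_in c th * x_in c th.
Proof.
  intros Hc; assert (Hr := R_in_pos c th Hc).
  split; [|unfold N_in; ring]; unfold A_in, B_in; rewrite <- sqrt_mult by nra.
  replace ((R_in c th + 2 * 0 * x_in c th + 0 ^ 2 * sin th ^ 2) *
     (c ^ 2 * R_in c th + 2 * 0 * x_in c th - 0 ^ 2 * cos th ^ 2))
    with ((c * R_in c th) ^ 2) by ring.
  apply sqrt_pow2; nra.
Qed.

Lemma int_y_out_center c t : 1 < c -> c < t ->
  int_y_out 0 c t = ellK_bar (m1 c t) / sqrt (t ^ 2 - 1).
Proof.
  intros Hc Ht; destruct (m1_range c t Hc Ht).
  assert (HT : 0 < sqrt (t ^ 2 - 1)) by (apply sqrt_lt_R0; nra).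
  unfold ellK_bar; rewrite ellK_delta.
  rewrite <- (RInt_reflect (fun th => / delta (1 - m1 c t) th))
    by (intros th; apply cont_inv_delta; lra).
  transitivity (/ sqrt (t ^ 2 - 1) * RInt (fun th => / delta (1 - m1 c t) (PI / 2 - th)) 0 (PI / 2));
    [|eq_R; unfold Rdiv; ring].
  rewrite <- RInt_mulc.
  - apply RInt_eq; intros th; unfold y_out, h_out.
    destruct (A_B_out_center c t th Hc Ht) as [E1 E2]; rewrite E1, E2, Z_out_delta by assumption.
    assert (Hd : 0 < delta (1 - m1 c t) (PI / 2 - th)) by (apply delta_pos; lra).
    destruct (x_out_bounds c t th Hc Ht).
    field; repeat split; try lra; nra.
  - intros th; apply (continuous_comp (fun v : R => PI / 2 - v) (fun v => / delta (1 - m1 c t) v)).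
    + assert (continuous (fun v : R => v) th) by apply continuous_id; cont.
    + apply cont_inv_delta; lra.
Qed.

(** At [s = 0] the term from [A * B] drops out and the slope is [- cos^2 / Z^3]; after reflecting
    the angle this is the integral of [sin^2 / delta^3], which brings in the second kind. *)
Lemma int_h_out_slope_center c t : 1 < c -> c < t ->
  int_h_out_slope 0 c t
  = - (ellE_bar (m1 c t) - m1 c t * ellK_bar (m1 c t))
    / ((1 - m1 c t) * m1 c t * ((t ^ 2 - 1) * sqrt (t ^ 2 - 1))).
Proof.
  intros Hc Ht; destruct (m1_range c t Hc Ht).
  assert (HT : 0 < sqrt (t ^ 2 - 1)) by (apply sqrt_lt_R0; nra).
  assert (HT2 : sqrt (t ^ 2 - 1) ^ 2 = t ^ 2 - 1) by (apply pow2_sqrt; nra).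
  set (f := fun th => sin th ^ 2 / delta (1 - m1 c t) th ^ 3).
  assert (Hcf : forall th, continuous f th).
  { intros th; assert (Hd : 0 < delta (1 - m1 c t) th) by (apply delta_pos; lra).
    assert (continuous (fun v : R => v) th) by apply continuous_id.
    assert (continuous (fun v => delta (1 - m1 c t) v) th) by apply cont_delta.
    unfold f; cont; apply Rgt_not_eq; now apply pow_lt. }
  transitivity (- / ((t ^ 2 - 1) * sqrt (t ^ 2 - 1)) * RInt f 0 (PI / 2)).
  - rewrite <- (RInt_reflect f) by exact Hcf.
    rewrite <- RInt_mulc.
    + apply RInt_eq; intros th; unfold h_out_slope, f; cbv zeta.
      destruct (A_B_out_center c t th Hc Ht) as [E1 E2]; rewrite E1, E2, Z_out_delta by assumption.
      assert (Hd : 0 < delta (1 - m1 c t) (PI / 2 - th)) by (apply delta_pos; lra).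
      destruct (x_out_bounds c t th Hc Ht).
      rewrite sin_shift; set (q := sqrt (t ^ 2 - 1)) in *; rewrite <- HT2.
      assert (t ^ 2 - c ^ 2 > 0) by nra.
      set (d := delta _ _) in *.
      assert (0 < q * d) by now apply Rmult_lt_0_compat.
      field; repeat split; lra.
    + intros th; apply (continuous_comp (fun v : R => PI / 2 - v) f); [|apply Hcf].
      assert (continuous (fun v : R => v) th) by apply continuous_id; cont.
  - unfold f; rewrite RInt_sin2_delta3 by lra.
    unfold ellE_bar, ellK_bar; set (q := sqrt (t ^ 2 - 1)) in *; rewrite <- HT2.
    eq_R; field; lra.
Qed.

Lemma int_h_in_center c t : 1 < c -> c < t ->
  int_h_in 0 c t = ellK (m2 c t) / (c * sqrt (t ^ 2 - 1)).
Proof.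
  intros Hc Ht; destruct (m2_range c t Hc Ht).
  assert (HT : 0 < sqrt (t ^ 2 - 1)) by (apply sqrt_lt_R0; nra).
  rewrite ellK_delta.
  transitivity (/ (c * sqrt (t ^ 2 - 1)) * RInt (fun th => / delta (m2 c t) th) 0 (PI / 2));
    [|eq_R; unfold Rdiv; ring].
  rewrite <- RInt_mulc by (intros th; now apply cont_inv_delta).
  apply RInt_eq; intros th; unfold h_in.
  destruct (A_B_in_center c th Hc) as [E1 E2]; rewrite E1, E2, W_in_delta by assumption.
  assert (Hd : 0 < delta (m2 c t) th) by (apply delta_pos; lra).
  destruct (x_in_bounds c th Hc). assert (Hr := R_in_pos c th Hc).
  field; repeat split; lra.
Qed.

Lemma int_y_in_slope_center c t : 1 < c -> c < t ->
  int_y_in_slope 0 c t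
  = ((ellE (m2 c t) - (1 - m2 c t) * ellK (m2 c t)) / (m2 c t * (1 - m2 c t)) / (t ^ 2 - 1)
     - (ellK (m2 c t) - ellE (m2 c t)) / m2 c t) / (c * sqrt (t ^ 2 - 1)).
Proof.
  intros Hc Ht; destruct (m2_range c t Hc Ht).
  assert (HT : 0 < sqrt (t ^ 2 - 1)) by (apply sqrt_lt_R0; nra).
  assert (HT2 : sqrt (t ^ 2 - 1) ^ 2 = t ^ 2 - 1) by (apply pow2_sqrt; nra).
  rewrite <- RInt_sin2_delta, <- RInt_sin2_delta3 by lra.
  set (f := fun th => sin th ^ 2 / delta (m2 c t) th ^ 3).
  set (g := fun th => sin th ^ 2 / delta (m2 c t) th).
  assert (Hcfg : forall th, continuous f th /\ continuous g th).
  { intros th; assert (Hd : 0 < delta (m2 c t) th) by (apply delta_pos; lra).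
    assert (continuous (fun v : R => v) th) by apply continuous_id.
    assert (continuous (fun v => delta (m2 c t) v) th) by apply cont_delta.
    split; unfold f, g; cont; apply Rgt_not_eq; [now apply pow_lt|assumption]. }
  assert (Hf : forall th, continuous (fun v => / (t ^ 2 - 1) * f v) th)
    by (intros th; exact (cont_mul (fun _ => / (t ^ 2 - 1)) f th (continuous_const _ th) (proj1 (Hcfg th)))).
  transitivity (/ (c * sqrt (t ^ 2 - 1)) *
    (/ (t ^ 2 - 1) * RInt f 0 (PI / 2) - RInt g 0 (PI / 2))); [|eq_R; unfold Rdiv; ring].
  rewrite <- (RInt_mulc f _ _ _ (fun th => proj1 (Hcfg th))).
  rewrite <- (RInt_sub _ _ _ _ Hf (fun th => proj2 (Hcfg th))).
  rewrite <- (RInt_mulc _ _ _ _ (fun th => cont_sub _ _ _ (Hf th) (proj2 (Hcfg th)))).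
  apply RInt_eq; intros th; unfold y_in_slope, f, g; cbv zeta.
  destruct (A_B_in_center c th Hc) as [E1 E2]; rewrite E1, E2, W_in_delta by assumption.
  assert (Hd : 0 < delta (m2 c t) th) by (apply delta_pos; lra).
  destruct (x_in_bounds c th Hc). assert (Hr := R_in_pos c th Hc).
  destruct (Delta_in_bounds c th Hc).
  assert (Hx := x_in_sqr c th Hc).
  assert (Hrx : c ^ 2 * R_in c th = (c ^ 2 - 1) * x_in c th ^ 2)
    by (rewrite Hx; unfold R_in; field; lra).
  (* With this identity the bracket in the slope becomes [(x / c) ((cos^2 - sin^2) - cos^2)], so the
     cosines cancel and [- sin^2 / delta] remains beside the [sin^2 / delta^3] from [W]. *)
  assert (HDx : 2 * c ^ 2 - x_in c th ^ 2 * (1 + c ^ 2)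
     = c ^ 2 * R_in c th * (cos th ^ 2 - sin th ^ 2)).
  { rewrite Hx; unfold R_in, Delta_in in *; rewrite cos2_sin2 in *; field; lra. }
  set (x := x_in c th) in *; set (r := R_in c th) in *; set (q := sqrt (t ^ 2 - 1)) in *.
  rewrite <- HT2.
  replace (4 * c ^ 2 * r * x - 2 * x ^ 3 * r * (1 + c ^ 2))
    with (2 * r * x * (2 * c ^ 2 - x ^ 2 * (1 + c ^ 2))) by ring.
  rewrite HDx.
  set (d := delta (m2 c t) th) in *.
  assert (0 < x * q * d) by (apply Rmult_lt_0_compat; [apply Rmult_lt_0_compat|]; lra).
  assert (0 < r * x) by (apply Rmult_lt_0_compat; lra).
  assert (0 < c * (r * x)) by (apply Rmult_lt_0_compat; lra).
  field; repeat split; try lra.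
Qed.

(** The square root [sqrt (t^2 - 1)] enters only through its square, and [1 - m1], [1 - m2] both
    have numerator [t^2 - c^2]; the identity is then rational in [c] and [t], and bilinear in the
    outer and inner elliptic integrals. *)
Lemma gap_center c t : 1 < c -> c < t ->
  gap 0 c t = 4 * c / ((c ^ 2 - 1) * (t ^ 2 - c ^ 2)) *
    (ellK_bar (m1 c t) * ellE (m2 c t) + ellE_bar (m1 c t) * ellK (m2 c t)
     - ellK_bar (m1 c t) * ellK (m2 c t)).
Proof.
  intros Hc Ht; unfold gap; rewrite Ropp_0.
  rewrite int_y_out_center, int_y_in_slope_center, int_h_out_slope_center, int_h_in_center
    by assumption.
  assert (HT : 0 < sqrt (t ^ 2 - 1)) by (apply sqrt_lt_R0; nra).
  assert (HT2 : sqrt (t ^ 2 - 1) ^ 2 = t ^ 2 - 1) by (apply pow2_sqrt; nra).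
  set (Kb := ellK_bar (m1 c t)); set (Eb := ellE_bar (m1 c t)).
  set (K := ellK (m2 c t)); set (E := ellE (m2 c t)).
  set (q := sqrt (t ^ 2 - 1)) in *.
  assert (H1 : c ^ 2 - 1 > 0) by nra. assert (H2 : t ^ 2 - c ^ 2 > 0) by nra.
  assert (H3 : 1 - m1 c t = (t ^ 2 - c ^ 2) / (t ^ 2 - 1)) by (unfold m1; field; lra).
  assert (H4 : 1 - m2 c t = (t ^ 2 - c ^ 2) / (c ^ 2 * (t ^ 2 - 1))) by (unfold m2; field; lra).
  rewrite H3, H4; unfold m1, m2.
  transitivity (4 * (Kb * (((E - (t ^ 2 - c ^ 2) / (c ^ 2 * (t ^ 2 - 1)) * K) /
     (t ^ 2 / c ^ 2 * ((c ^ 2 - 1) / (t ^ 2 - 1)) * ((t ^ 2 - c ^ 2) / (c ^ 2 * (t ^ 2 - 1)))) / (t ^ 2 - 1)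
     - (K - E) / (t ^ 2 / c ^ 2 * ((c ^ 2 - 1) / (t ^ 2 - 1)))) / c)
    + c ^ 2 * ((Eb - (c ^ 2 - 1) / (t ^ 2 - 1) * Kb) /
       ((t ^ 2 - c ^ 2) / (t ^ 2 - 1) * ((c ^ 2 - 1) / (t ^ 2 - 1)) * (t ^ 2 - 1)) * (K / c))) / q ^ 2).
  - field; repeat split; lra.
  - rewrite HT2; field; repeat split; lra.
Qed.

(** * The closure of the off-diagonal family *)

Lemma ellK_pos m : m < 1 -> 0 < ellK m.
Proof.
  intros Hm; rewrite ellK_delta; apply RInt_gt_0.
  - generalize PI_RGT_0; lra.
  - intros th _; apply Rinv_0_lt_compat; now apply delta_pos.
  - intros th _; now apply cont_inv_delta.
Qed.

Lemma ellE_le_ellK m : 0 < m < 1 -> ellE m <= ellK m.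
Proof.
  intros Hm; rewrite ellK_delta.
  change (ellE m) with (RInt (fun th => delta m th) 0 (PI / 2)).
  apply RInt_le.
  - generalize PI_RGT_0; lra.
  - apply ex_RInt_cont, cont_delta.
  - apply ex_RInt_cont; intros th; now apply cont_inv_delta.
  - intros th _.
    assert (Hd := delta_pos m th (proj2 Hm)).
    assert (Hs := delta_sqr m th (proj2 Hm)); destruct (sin2_range th).
    assert (delta m th <= 1) by nra.
    apply (Rmult_le_reg_r (delta m th)); [assumption|].
    rewrite Rinv_l by lra; nra.
Qed.

(* The integrand of the left-hand side is [k u - (k - e) / u] with
   [u = sqrt (1 - m sin^2)], increasing in [u]. *)
Lemma ell_combination_decr (k e m m' : R) : 0 < k -> e <= k -> m < m' -> m' < 1 ->
  k * ellE m' + e * ellK m' - k * ellK m' < k * ellE m + e * ellK m - k * ellK m.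
Proof.
  intros Hk He Hmm Hm'.
  assert (Hc : forall n th, n < 1 -> continuous (fun v => k * delta n v - (k - e) * / delta n v) th).
  { intros n th Hn.
    assert (continuous (fun v => delta n v) th) by apply cont_delta.
    assert (continuous (fun v => / delta n v) th) by now apply cont_inv_delta.
    cont. }
  assert (Hint : forall n, n < 1 -> k * ellE n + e * ellK n - k * ellK n
     = RInt (fun th => k * delta n th - (k - e) * / delta n th) 0 (PI / 2)).
  { intros n Hn.
    assert (Hi := fun th => cont_inv_delta n th Hn).
    rewrite (RInt_sub (fun th => k * delta n th) (fun th => (k - e) * / delta n th)).
    - rewrite (RInt_mulc _ _ _ _ (cont_delta n)), (RInt_mulc _ _ _ _ Hi), <- ellK_delta.
      change (k * ellE n + e * ellK n - k * ellK n = k * ellE n - (k - e) * ellK n); ring.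
    - intros th; exact (cont_mul (fun _ => k) _ th (continuous_const _ th) (cont_delta n th)).
    - intros th; exact (cont_mul (fun _ => k - e) _ th (continuous_const _ th) (Hi th)). }
  rewrite !Hint by lra.
  apply RInt_lt.
  - generalize PI_RGT_0; lra.
  - intros th _; apply Hc; lra.
  - intros th _; now apply Hc.
  - intros th Hth; destruct (sin_cos_pos th Hth) as [Hs _].
    assert (Hd : 0 < delta m th) by (apply delta_pos; lra).
    assert (Hd' : 0 < delta m' th) by now apply delta_pos.
    assert (Hlt : delta m' th < delta m th).
    { apply sqrt_lt_1_alt; split; [apply Rlt_le; now apply delta_sqr_pos|].
      assert (0 < sin th ^ 2) by now apply pow_lt. nra. }
    assert (/ delta m th < / delta m' th) by (apply Rinv_lt_contravar; [nra|assumption]).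
    nra.
Qed.

Lemma locally_pos {U : UniformSpace} (f : U -> R) u :
  continuous f u -> 0 < f u -> locally u (fun v => 0 < f v).
Proof. intros Hf Hp; exact (Hf _ (open_gt 0 _ Hp)). Qed.

Lemma Q_zero_iff s c t : near_diagonal s c t -> s <> 0 ->
  (Q (c - s) (c + s) t = 0 <-> gap s c t = 0).
Proof.
  intros H Hs; destruct (Q_gap s c t H) as [k [Hk ->]]; split; intros HQ.
  - destruct (Rmult_integral _ _ HQ) as [|HQ']; [lra|].
    destruct (Rmult_integral _ _ HQ'); [contradiction|assumption].
  - rewrite HQ; ring.
Qed.

(** If [gap] were nonzero at the centre, it would be nonzero nearby by continuity in [s] and [c],
    read as functions of [(a, b, t)]. Off-diagonal points of that neighbourhood could then not be
    zeros of [Q]. *)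
Lemma gap_center_of_closure a t : 1 < a -> a < t ->
  closure oDelta (a, a, t) -> gap 0 a t = 0.
Proof.
  intros Ha Ht Hcl; destruct (Req_dec (gap 0 a t) 0) as [|Hne]; [assumption|exfalso].
  set (U := prod_UniformSpace (prod_UniformSpace R_UniformSpace R_UniformSpace) R_UniformSpace).
  set (s := fun p : U => (snd (fst p) - fst (fst p)) / 2).
  set (c := fun p : U => (snd (fst p) + fst (fst p)) / 2).
  assert (Ca : continuous (fun p : U => fst (fst p)) (a, a, t)).
  { apply (continuous_comp (U := U) fst fst); apply continuous_fst. }
  assert (Cb : continuous (fun p : U => snd (fst p)) (a, a, t)).
  { apply (continuous_comp (U := U) fst snd); [apply continuous_fst|apply continuous_snd]. }
  assert (Ct : continuous (fun p : U => snd p) (a, a, t)) by apply continuous_snd.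
  assert (Cs : continuous s (a, a, t)) by (unfold s; cont; lra).
  assert (Cc : continuous c (a, a, t)) by (unfold c; cont; lra).
  assert (Es : s (a, a, t) = 0) by (unfold s; simpl; field).
  assert (Ec : c (a, a, t) = a) by (unfold c; simpl; field).
  assert (Hn : near_diagonal (s (a, a, t)) (c (a, a, t)) t)
    by (rewrite Es, Ec; now apply near_diagonal_0).
  destruct (Hcl (fun p : U => near_diagonal (s p) (c p) (snd p)
                   /\ 0 < Rabs (gap (s p) (c p) (snd p)))) as [[[a' b'] t'] [[N G] HD]].
  - apply filter_and.
    + exact (continuous_triple s c (fun p : U => snd p) (a, a, t) Cs Cc Ct _
              (near_diagonal_open _ _ _ Hn)).
    + apply locally_pos.
      * apply cont_abs, (continuous_gap s c (fun p : U => snd p)); assumption.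
      * cbv beta; rewrite Es, Ec; apply Rabs_pos_lt; exact Hne.
  - destruct HD as [HQ [Hab _]].
    set (s' := s (a', b', t')) in *; set (c' := c (a', b', t')) in *; simpl in N, G.
    replace a' with (c' - s') in HQ by (unfold c', s', c, s; simpl; field).
    replace b' with (c' + s') in HQ by (unfold c', s', c, s; simpl; field).
    assert (Hs' : s' <> 0) by (unfold s', s; simpl; lra).
    apply (Q_zero_iff _ _ _ N Hs') in HQ.
    rewrite HQ, Rabs_R0 in G; lra.
Qed.

(* The solution [c] of [m1 c t = m]. *)
Definition level_curve (m t : R) : R := sqrt (1 + m * (t ^ 2 - 1)).

Lemma level_curve_spec m t : 0 < m < 1 -> 1 < t ->
  level_curve m t ^ 2 = 1 + m * (t ^ 2 - 1) /\
  1 < level_curve m t < t /\ m1 (level_curve m t) t = m.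
Proof.
  intros Hm Ht.
  assert (HT : 0 < t ^ 2 - 1) by nra.
  assert (E : level_curve m t ^ 2 = 1 + m * (t ^ 2 - 1)) by (apply pow2_sqrt; nra).
  assert (Hp : 0 <= level_curve m t) by apply sqrt_pos.
  assert (1 < level_curve m t ^ 2 < t ^ 2) by (rewrite E; split; nra).
  split; [exact E|split; [split; apply Rnot_le_lt; intros Hn; nra|]].
  unfold m1; rewrite E; field; lra.
Qed.

Lemma cont_level_curve m t : continuous (fun v => level_curve m v) t.
Proof.
  assert (continuous (fun v : R => v) t) by apply continuous_id.
  unfold level_curve; cont.
Qed.

(** Along the curve [m2 = m t^2 / ((1 - m) + m t^2)], increasing in [t] because [0 < m < 1]. *)
Lemma m2_level_curve_incr m t t' : 0 < m < 1 -> 1 < t -> t < t' ->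
  m2 (level_curve m t) t < m2 (level_curve m t') t'.
Proof.
  intros Hm Ht Htt.
  destruct (level_curve_spec m t Hm Ht) as (E & _ & M).
  destruct (level_curve_spec m t' Hm) as (E' & _ & M'); [lra|].
  change (m2 (level_curve m t) t) with (t ^ 2 / level_curve m t ^ 2 * m1 (level_curve m t) t).
  change (m2 (level_curve m t') t')
    with (t' ^ 2 / level_curve m t' ^ 2 * m1 (level_curve m t') t').
  rewrite E, E', M, M'.
  apply Rmult_lt_compat_r; [lra|].
  assert (0 < t ^ 2 - 1) by nra. assert (t ^ 2 < t' ^ 2) by nra.
  assert (0 < 1 + m * (t ^ 2 - 1)) by nra. assert (0 < 1 + m * (t' ^ 2 - 1)) by nra.
  apply (Rmult_lt_reg_r ((1 + m * (t ^ 2 - 1)) * (1 + m * (t' ^ 2 - 1)))).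
  - now apply Rmult_lt_0_compat.
  - field_simplify; nra.
Qed.

Lemma gap_center_sign c t : 1 < c -> c < t ->
  exists k, 0 < k /\ gap 0 c t = k *
    (ellK_bar (m1 c t) * ellE (m2 c t) + ellE_bar (m1 c t) * ellK (m2 c t)
     - ellK_bar (m1 c t) * ellK (m2 c t)).
Proof.
  intros Hc Ht; eexists; split; [|now apply gap_center].
  apply Rdiv_lt_0_compat; [lra|apply Rmult_lt_0_compat; nra].
Qed.

(** On the curve the two associated integrals are constants, so only [m2] varies and
    [ell_combination_decr] applies. The positive factor in front differs between the two points;
    hence signs are compared, not values. *)
Lemma gap_level_curve_sign m t t' : 0 < m < 1 -> 1 < t -> t < t' ->
  (gap 0 (level_curve m t) t = 0 -> gap 0 (level_curve m t') t' < 0) /\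
  (gap 0 (level_curve m t') t' = 0 -> 0 < gap 0 (level_curve m t) t).
Proof.
  intros Hm Ht Htt; assert (Ht' : 1 < t') by lra.
  destruct (level_curve_spec m t Hm Ht) as (_ & [C1 C2] & M).
  destruct (level_curve_spec m t' Hm Ht') as (_ & [C1' C2'] & M').
  destruct (gap_center_sign _ _ C1 C2) as [k [Hk Ek]].
  destruct (gap_center_sign _ _ C1' C2') as [k' [Hk' Ek']].
  rewrite M in Ek; rewrite M' in Ek'.
  assert (HK : 0 < ellK_bar m) by (apply ellK_pos; lra).
  assert (HE : ellE_bar m <= ellK_bar m) by (apply ellE_le_ellK; lra).
  assert (H := ell_combination_decr _ _ _ _ HK HE (m2_level_curve_incr m t t' Hm Ht Htt)
                 (proj2 (m2_range _ _ C1' C2'))).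
  rewrite Ek, Ek'; split; intros H0; destruct (Rmult_integral _ _ H0); nra.
Qed.

(** On the curve [c^2 - 1 = m (t^2 - 1)] and [t^2 - c^2 = (1 - m) (t^2 - 1)]. A single [s] therefore
    works on all of [[r, r']], as the intermediate value argument at fixed [s] requires. *)
Lemma near_diagonal_level_curve m r r' s t : 0 < m < 1 -> 1 < r -> r <= t <= r' -> 0 < s ->
  4 * s * r' ^ 3 < m * (r ^ 2 - 1) -> 4 * s * r' ^ 3 < (1 - m) * (r ^ 2 - 1) ->
  near_diagonal s (level_curve m t) t.
Proof.
  intros Hm Hr Ht Hs H1 H2.
  destruct (level_curve_spec m t Hm) as (E & [C1 C2] & _); [lra|].
  unfold near_diagonal; rewrite (Rabs_pos_eq s), E by lra.
  assert (t ^ 3 <= r' ^ 3) by (apply pow_incr; lra).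
  assert (r ^ 2 <= t ^ 2) by (apply pow_incr; lra).
  assert (1 <= t ^ 2) by nra.
  assert (t <= t ^ 3) by nra.
  split; [exact C1|split; [exact C2|split]]; nra.
Qed.

Lemma closure_of_gap_center a t : 1 < a -> a < t ->
  gap 0 a t = 0 -> closure oDelta (a, a, t).
Proof.
  intros Ha Ht H0 P [d HP].
  assert (Hm := m1_range a t Ha Ht); set (m := m1 a t) in *.
  assert (Hca : level_curve m t = a).
  { unfold level_curve, m, m1.
    replace (1 + (a ^ 2 - 1) / (t ^ 2 - 1) * (t ^ 2 - 1)) with (a ^ 2) by (field; nra).
    apply sqrt_pow2; lra. }
  assert (Hd := cond_pos d).
  destruct (proj1 (filterlim_locally _ _) (cont_level_curve m t) (pos_div_2 d)) as [e He].
  assert (Hem := cond_pos e).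
  (* The three bounds keep [c] within [d / 2] of [a], keep the third coordinate within [d] of [t],
     and keep [r > 1]. *)
  set (eta := Rmin (Rmin (e / 2) (d / 2)) ((t - 1) / 2)).
  assert (Heta : 0 < eta) by (repeat apply Rmin_pos; lra).
  assert (Heta1 : eta <= e / 2) by (eapply Rle_trans; [apply Rmin_l|apply Rmin_l]).
  assert (Heta2 : eta <= d / 2) by (eapply Rle_trans; [apply Rmin_l|apply Rmin_r]).
  assert (Heta3 : eta <= (t - 1) / 2) by apply Rmin_r.
  set (r := t - eta); set (r' := t + eta).
  assert (Hr : 1 < r) by (unfold r; lra). assert (Hrt : r < t) by (unfold r; lra).
  assert (Hrt' : t < r') by (unfold r'; lra).
  assert (Gr : 0 < gap 0 (level_curve m r) r)
    by (apply (gap_level_curve_sign m r t Hm Hr Hrt); now rewrite Hca).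
  assert (Gr' : gap 0 (level_curve m r') r' < 0)
    by (apply (gap_level_curve_sign m t r' Hm (Rlt_trans _ _ _ Ha Ht) Hrt'); now rewrite Hca).
  assert (Cgap : forall u, 1 < u -> continuous (fun s => gap s (level_curve m u) u) 0).
  { intros u Hu; apply (continuous_gap (fun s => s) (fun _ => level_curve m u) (fun _ => u));
      [apply continuous_id|apply continuous_const|apply continuous_const|].
    destruct (level_curve_spec m u Hm Hu) as (_ & [C1 C2] & _); now apply near_diagonal_0. }
  destruct (locally_pos _ _ (Cgap r Hr) Gr) as [d1 Hd1].
  assert (Hr' : 1 < r') by lra.
  destruct (locally_pos _ _ (cont_opp _ _ (Cgap r' Hr'))) as [d2 Hd2]; [lra|].
  assert (Hd1p := cond_pos d1). assert (Hd2p := cond_pos d2).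
  assert (Hr3 : 0 < r' ^ 3) by (apply pow_lt; lra).
  assert (Hr2 : 0 < r ^ 2 - 1) by nra.
  (* The bounds by [d1] and [d2] preserve the signs of [gap] at [r] and [r']; [d / 4] keeps [c - s]
     and [c + s] within [d] of [a]; the last two give [near_diagonal], with 8 in place of 4 for
     strictness. *)
  set (s := Rmin (Rmin (d1 / 2) (d2 / 2)) (Rmin (d / 4)
              (Rmin (m * (r ^ 2 - 1) / (8 * r' ^ 3)) ((1 - m) * (r ^ 2 - 1) / (8 * r' ^ 3))))).
  assert (S0 : 0 < s).
  { repeat apply Rmin_pos; try lra; apply Rdiv_lt_0_compat; try lra;
      apply Rmult_lt_0_compat; lra. }
  assert (S1 : s <= d1 / 2) by (eapply Rle_trans; [apply Rmin_l|apply Rmin_l]).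
  assert (S2 : s <= d2 / 2) by (eapply Rle_trans; [apply Rmin_l|apply Rmin_r]).
  assert (S3 : s <= d / 4) by (eapply Rle_trans; [apply Rmin_r|apply Rmin_l]).
  assert (S4 : s <= m * (r ^ 2 - 1) / (8 * r' ^ 3))
    by (eapply Rle_trans; [apply Rmin_r|eapply Rle_trans; [apply Rmin_r|apply Rmin_l]]).
  assert (S5 : s <= (1 - m) * (r ^ 2 - 1) / (8 * r' ^ 3))
    by (eapply Rle_trans; [apply Rmin_r|eapply Rle_trans; [apply Rmin_r|apply Rmin_r]]).
  clearbody s.
  assert (S6 : forall k, 0 < k -> s <= k * (r ^ 2 - 1) / (8 * r' ^ 3) ->
     4 * s * r' ^ 3 < k * (r ^ 2 - 1)).
  { intros k Hk Hsk.
    apply (Rmult_le_compat_r (8 * r' ^ 3)) in Hsk; [|lra].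
    replace (k * (r ^ 2 - 1) / (8 * r' ^ 3) * (8 * r' ^ 3)) with (k * (r ^ 2 - 1)) in Hsk by (field; lra).
    assert (0 < s * r' ^ 3) by (apply Rmult_lt_0_compat; lra).
    lra. }
  assert (N : forall u, r <= u <= r' -> near_diagonal s (level_curve m u) u).
  { intros u Hu; apply (near_diagonal_level_curve m r r'); try assumption; apply S6; lra. }
  assert (Hball : forall e' : posreal, s <= e' / 2 -> ball 0 e' s).
  { intros e' He'; generalize (cond_pos e'); intros.
    apply Rabs_def1; unfold minus, plus, opp; simpl; lra. }
  specialize (Hd1 s (Hball d1 S1)); specialize (Hd2 s (Hball d2 S2)); simpl in Hd1, Hd2.
  (* The sign is reversed because the theorem wants a negative value on the left and a positive one
     on the right. *)
  destruct (IVT_interv (fun u => - gap s (level_curve m u) u) r r') as [u [Hu Hzero]].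
  - intros u Hu; apply continuous_continuity, cont_opp.
    apply (continuous_gap (fun _ => s) (fun u => level_curve m u) (fun u => u));
      [apply continuous_const|apply cont_level_curve|apply continuous_id|now apply N].
  - lra.
  - lra.
  - exact Hd2.
  - set (c := level_curve m u) in *.
    assert (Hball_c : Rabs (c - a) < d / 2).
    { rewrite <- Hca; apply (He u).
      apply Rabs_def1; unfold minus, plus, opp; simpl; unfold r, r' in Hu; lra. }
    apply Rabs_def2 in Hball_c.
    exists (c - s, c + s, u); split.
    + apply HP; unfold r, r' in Hu; repeat split; apply Rabs_def1;
        unfold minus, plus, opp; simpl; lra.
    + specialize (N u Hu); fold c in N.
      destruct (near_diagonal_bounds _ _ _ N) as (B1 & B2 & B3 & B4 & B5 & B6 & _).
      split; [apply (Q_zero_iff _ _ _ N); lra|].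
      split; [lra|]; unfold admissible; repeat split; lra.
Qed.

Theorem theorem5p1 :
  forall a t : R, 1 < a < t ->
    oD (a, a, t) /\
    (closure oDelta (a, a, t) <->
     ellK_bar (m1 a t) * ellE (m2 a t) + ellE_bar (m1 a t) * ellK (m2 a t)
     = ellK_bar (m1 a t) * ellK (m2 a t)).
Proof.
  intros a t [Ha Ht].
  destruct (gap_center_sign a t Ha Ht) as [k [Hk Ek]].
  split; [|split].
  - split; [|split; [reflexivity|unfold admissible; repeat split; lra]].
    (* The factor [s = 0] makes [Q] vanish, so every diagonal point lies in [oD]. *)
    destruct (Q_gap 0 a t (near_diagonal_0 a t Ha Ht)) as [k' [_ Ek']].
    rewrite Rminus_0_r, Rplus_0_r in Ek'; rewrite Ek'; ring.
  - intros Hcl; apply gap_center_of_closure in Hcl; [|assumption|assumption].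
    rewrite Ek in Hcl; destruct (Rmult_integral _ _ Hcl); lra.
  - intros H; apply closure_of_gap_center; [assumption|assumption|].
    rewrite Ek, H; ring.
Qed.
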